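(* Consider the $6$-dimensional Wallach flag manifold $\mathrm{SU}(3)/\mathrm{T}^2$. For every $d\in\{1,\ldots,5\}$ the set $\mathcal{R}^{\mathrm{sec\text{-}Ric}}_d$ is non-empty. Moreover: (a) for each $d\in\{1,2,3,5\}$ there exist an invariant Riemannian metric $g=(x_0,y_0)\in\mathcal{R}^{\mathrm{sec\text{-}Ric}}_d$ and $t^*\in\mathbb{R}$ such that the projected homogeneous Ricci flow $g(t)=(x(t),y(t))$ with initial condition $g(0)=g$ satisfies $g(t)\in\mathcal{R}^{\mathrm{sec\text{-}Ric}}_d$ for all sufficiently small $t$, and $g(t)\notin\mathcal{R}^{\mathrm{sec\text{-}Ric}}_d$ for every $t$ in a neighborhood of $t^*$; (b) for each $d\in\{4,5\}$ there exists a region $\mathcal{R}_d\subseteq\mathcal{R}^{\mathrm{sec\text{-}Ric}}_d$ such that for every invariant Riemannian metric $g=(x_0,y_0)\in\mathcal{R}_d$ the projected homogeneous Ricci flow $g(t)$ with $g(0)=g$ lies in $\mathcal{R}_d$ for every $t\in\mathbb{R}$. Moreover, one has $\mathcal{R}_4=\mathcal{R}^{\mathrm{sec\text{-}Ric}}_4$ (which is open) and $\mathcal{R}_5=\overline{\mathcal{R}_4}\setminus\{(1/2,0),(0,1/2),(1/2,1/2)\}\subsetneq\mathcal{R}^{\mathrm{sec\text{-}Ric}}_5$.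
   Context: Invariant metrics. $\mathrm{T}^2\subset\mathrm{SU}(3)$ is the maximal torus of diagonal matrices. For $1\le j<k\le 3$ let $\mathrm{A}_{jk}$ be the antisymmetric $3\times3$ matrix with entry $1$ in position $kj$, $-1$ in position $jk$ and $0$ elsewhere, and let $\mathrm{S}_{jk}$ be the symmetric $3\times 3$ matrix with entry $\mathrm{i}=\sqrt{-1}$ in positions $jk$ and $kj$ and $0$ elsewhere. The tangent space of $\mathrm{SU}(3)/\mathrm{T}^2$ at the base point is identified with $\mathfrak m=\mathfrak m_{12}\oplus\mathfrak m_{13}\oplus\mathfrak m_{23}$, $\mathfrak m_{jk}=\mathrm{span}_{\mathbb{R}}\{\frac12\mathrm{A}_{jk},\frac12\mathrm{S}_{jk}\}$, the decomposition into irreducible pairwise non-equivalent isotropy representations. Every $\mathrm{SU}(3)$-invariant Riemannian metric is determined by positive numbers $(x,y,z)$: the six vectors $\frac12\mathrm{A}_{jk},\frac12\mathrm{S}_{jk}$ are mutually orthogonal and $g(\frac12\mathrm{A}_{12},\frac12\mathrm{A}_{12})=g(\frac12\mathrm{S}_{12},\frac12\mathrm{S}_{12})=x$, $g(\frac12\mathrm{A}_{13},\frac12\mathrm{A}_{13})=g(\frac12\mathrm{S}_{13},\frac12\mathrm{S}_{13})=y$, $g(\frac12\mathrm{A}_{23},\frac12\mathrm{A}_{23})=g(\frac12\mathrm{S}_{23},\frac12\mathrm{S}_{23})=z$. It is always assumed that $x+y+z=1$, and the metric $(x,y,1-x-y)$ is denoted by $(x,y)$; thus invariant metrics are identified with points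 $(x,y)\in\mathbb{R}^2$ with $x>0$, $y>0$, $x+y<1$. Intermediate Ricci curvature. For a point $p$ of a Riemannian manifold $(M,g)$ and orthonormal vectors $v,v_1,\ldots,v_d\in T_pM$, set $\mathrm{Ric}_d(v)=\sum_{i=1}^d K(v,v_i)$, where $K$ is the sectional curvature of $g$. $(M,g)$ has positive $d$th-intermediate Ricci curvature if $\mathrm{Ric}_d(v)>0$ for every $p\in M$ and every choice of orthonormal vectors $v,v_1,\ldots,v_d\in T_pM$. For $d\in\{1,\ldots,n-1\}$, $n=\dim M$, $\mathcal{R}^{\mathrm{sec\text{-}Ric}}_d$ denotes the set of Riemannian metrics with positive $d$th-intermediate Ricci curvature; on $\mathrm{SU}(3)/\mathrm{T}^2$ it is considered among invariant metrics, hence as a set of points $(x,y)$ in the plane. Openness and the closure $\overline{\mathcal{R}_4}$ refer to the plane $\mathbb{R}^2$. Projected homogeneous Ricci flow. This is the flow of the planar system $x'=u(x,y)$, $y'=v(x,y)$ on the triangle $\{x\ge0,\ y\ge0,\ x+y\le1\}$, where $u(x,y)=2x\left(x^2(2-12y)-3x(4y^2-6y+1)+6y^2-6y+1\right)$ and $v(x,y)=-2y(2y-1)\left(6x^2+6x(y-1)-y+1\right)$ (obtained from the homogeneous Ricci flow by a time reparametrization and projection to $x+y+z=1$). *)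

(* Defs.v *)
From HB Require Import structures.
From mathcomp Require Import all_boot all_order all_algebra.
From mathcomp Require Import complex.
From mathcomp Require Import ring.
From mathcomp Require Import all_classical all_reals all_analysis.
Set Implicit Arguments.
Unset Strict Implicit.
Unset Printing Implicit Defensive.
Import Order.TTheory GRing.Theory Num.Theory numFieldNormedType.Exports.

Local Open Scope classical_set_scope.
Local Open Scope ring_scope.

Section Flag.
Variable R : realType.
Local Notation C := R[i].

Definition i1 : 'I_3 := @Ordinal 3 0 isT.
Definition i2 : 'I_3 := @Ordinal 3 1 isT.
Definition i3 : 'I_3 := @Ordinal 3 2 isT.

Definition Amx (j k : 'I_3) : 'M[C]_3 := delta_mx k j - delta_mx j k.
Definition Smx (j k : 'I_3) : 'M[C]_3 :=
  ('i%C : C) *: (delta_mx j k + delta_mx k j).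

Definition frame (i : 'I_6) : 'M[C]_3 :=
  (2%:R^-1 : C) *: tnth [tuple Amx i1 i2; Smx i1 i2; Amx i1 i3; Smx i1 i3;
                               Amx i2 i3; Smx i2 i3] i.

(* A tangent vector at the base point of SU(3)/T^2 is given by its six real
   coordinates in [frame]; [mmx] is the corresponding element of m. *)
Definition vec : Type := 'rV[R]_6.
Definition mmx (a : vec) : 'M[C]_3 := \sum_i ((a 0 i)%:C)%C *: frame i.

Definition lie (X Y : 'M[C]_3) : 'M[C]_3 := X *m Y - Y *m X.

(* The two components of su(3) = t + m: the diagonal part, and the
   [frame]-coordinates of the off-diagonal part (see [su3_decomp]). *)
Definition tpart (X : 'M[C]_3) : 'M[C]_3 := \matrix_(i, j) (X i j *+ (i == j)).
Definition mpart (X : 'M[C]_3) : vec :=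
  \row_i tnth [tuple 2 * complex.Re (X i2 i1); 2 * complex.Im (X i2 i1);
                     2 * complex.Re (X i3 i1); 2 * complex.Im (X i3 i1);
                     2 * complex.Re (X i3 i2); 2 * complex.Im (X i3 i2)] i.

Definition liem (a b : vec) : vec := mpart (lie (mmx a) (mmx b)).
Definition liet (a b : vec) : 'M[C]_3 := tpart (lie (mmx a) (mmx b)).

Definition inv_metric : set (R * R) :=
  [set g | [/\ 0 < g.1, 0 < g.2 & g.1 + g.2 < 1]].

Definition weight (g : R * R) (i : 'I_6) : R :=
  tnth [tuple g.1; g.1; g.2; g.2; 1 - g.1 - g.2; 1 - g.1 - g.2] i.

Definition inner (g : R * R) (a b : vec) : R :=
  \sum_i weight g i * a 0 i * b 0 i.

(* Levi-Civita connection of an invariant metric on a reductive homogeneous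
   space, as a bilinear map m x m -> m (Nomizu): it is [a, b]_m / 2 + U(a, b)
   where, for every c in m,
     2 g(U(a, b), c) = g([c, a]_m, b) + g(a, [c, b]_m).
   It is characterized by [nomizu_torsion] and [nomizu_metric]. *)
Definition Uterm (g : R * R) (a b : vec) : vec :=
  \row_i ((inner g (liem (delta_mx 0 i) a) b
           + inner g a (liem (delta_mx 0 i) b)) / (2 * weight g i)).
Definition nomizu (g : R * R) (a b : vec) : vec :=
  2^-1 *: liem a b + Uterm g a b.

(* Curvature tensor at the base point; the last term is [[a, b]_t, c]. *)
Definition curvature (g : R * R) (a b c : vec) : vec :=
  nomizu g a (nomizu g b c) - nomizu g b (nomizu g a c)
  - nomizu g (liem a b) c - mpart (lie (liet a b) (mmx c)).

Definition sectional (g : R * R) (a b : vec) : R :=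
  inner g (curvature g a b b) a
  / (inner g a a * inner g b b - inner g a b ^+ 2).

Definition orthonormal (g : R * R) (d : nat) (v : vec) (w : 'I_d -> vec) :=
  [/\ inner g v v = 1,
      (forall i, inner g v (w i) = 0)
    & (forall i j, inner g (w i) (w j) = (i == j)%:R)].

Definition Ric (g : R * R) (d : nat) (v : vec) (w : 'I_d -> vec) : R :=
  \sum_(i < d) sectional g v (w i).

(* By SU(3)-invariance it suffices to consider vectors at the base point. *)
Definition secRic (d : nat) : set (R * R) :=
  [set g | inv_metric g /\
    forall (v : vec) (w : 'I_d -> vec), orthonormal g v w -> 0 < Ric g v w].

Definition triangle : set (R * R) :=
  [set p | [/\ 0 <= p.1, 0 <= p.2 & p.1 + p.2 <= 1]].

Definition ufield (p : R * R) : R := let: (x, y) := p in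
  2 * x * (x ^+ 2 * (2 - 12 * y) - 3 * x * (4 * y ^+ 2 - 6 * y + 1)
           + 6 * y ^+ 2 - 6 * y + 1).
Definition vfield (p : R * R) : R := let: (x, y) := p in
  - 2 * y * (2 * y - 1) * (6 * x ^+ 2 + 6 * x * (y - 1) - y + 1).

Definition integral_curve (c : R -> R * R) : Prop :=
  forall t : R, is_derive t 1 (fun s => (c s).1) (ufield (c t)) /\
                is_derive t 1 (fun s => (c s).2) (vfield (c t)).

(* [phi p t] is the value at time t of the flow starting at p. *)
Definition projected_flow (phi : R * R -> R -> R * R) : Prop :=
  forall p, triangle p ->
    [/\ integral_curve (phi p), phi p 0 = p, (forall t, triangle (phi p t))
      & forall c, integral_curve c -> c 0 = p -> forall t, c t = phi p t].

Lemma mpartD X Y : mpart (X + Y) = mpart X + mpart Y.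
Proof.
apply/rowP => i; rewrite !mxE; case: i => [[|[|[|[|[|[|//]]]]]] Hi];
  by rewrite /tnth /= raddfD mulrDr.
Qed.

Lemma mpartZ (r : R) X : mpart ((r%:C)%C *: X) = r *: mpart X.
Proof.
apply/rowP => i; rewrite !mxE; case: i => [[|[|[|[|[|[|//]]]]]] Hi];
  rewrite /tnth /=; case: (X _ _) => s t /=;
  by rewrite !mul0r ?subr0 ?addr0 mulrCA.
Qed.

Lemma mpart0 : mpart 0 = 0.
Proof. by have := mpartZ 0 0; rewrite scaler0 scale0r. Qed.

Lemma mpartN X : mpart (- X) = - mpart X.
Proof. by apply/eqP; rewrite -addr_eq0 -mpartD addNr mpart0. Qed.

Lemma mmxD a b : mmx (a + b) = mmx a + mmx b.
Proof.
rewrite /mmx -big_split /=; apply: eq_bigr => i _.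
by rewrite mxE rmorphD scalerDl.
Qed.

Lemma mmxZ (r : R) a : mmx (r *: a) = (r%:C)%C *: mmx a.
Proof.
rewrite /mmx scaler_sumr; apply: eq_bigr => i _.
by rewrite mxE rmorphM scalerA.
Qed.

Lemma liemC a b : liem a b = - liem b a.
Proof. by rewrite /liem -mpartN /lie opprB. Qed.

Lemma liemDl a b c : liem (a + b) c = liem a c + liem b c.
Proof.
rewrite /liem -mpartD /lie mmxD mulmxDl mulmxDr; congr mpart.
by rewrite opprD addrACA.
Qed.

Lemma liemZl r a c : liem (r *: a) c = r *: liem a c.
Proof. by rewrite /liem -mpartZ /lie mmxZ -scalemxAl -scalemxAr -scalerBr. Qed.

Lemma innerC g a b : inner g a b = inner g b a.
Proof. by apply: eq_bigr => i _; rewrite mulrAC. Qed.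

Lemma innerDl g a b c : inner g (a + b) c = inner g a c + inner g b c.
Proof.
by rewrite /inner -big_split; apply: eq_bigr => i _; rewrite mxE mulrDr mulrDl.
Qed.

Lemma innerZl g r a c : inner g (r *: a) c = r * inner g a c.
Proof.
by rewrite /inner mulr_sumr; apply: eq_bigr => i _; rewrite mxE mulrCA !mulrA.
Qed.

Lemma innerNl g a b : inner g (- a) b = - inner g a b.
Proof. by rewrite -scaleN1r innerZl mulN1r. Qed.

Lemma innerNr g a b : inner g a (- b) = - inner g a b.
Proof. by rewrite innerC innerNl innerC. Qed.

Lemma weight_gt0 g i : inv_metric g -> 0 < weight g i.
Proof.
move=> [g1 g2 g12]; have g3 : 0 < 1 - g.1 - g.2 by rewrite -addrA -opprD subr_gt0.
by case: i => [[|[|[|[|[|[|//]]]]]] Hi]; rewrite /weight /tnth.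
Qed.

Lemma inner_Uterm g a b c : inv_metric g ->
  inner g (Uterm g a b) c
  = 2^-1 * (inner g (liem c a) b + inner g a (liem c b)).
Proof.
move=> gm.
pose K c' := inner g (liem c' a) b + inner g a (liem c' b).
have KD c1 c2 : K (c1 + c2) = K c1 + K c2.
  rewrite /K !liemDl.
  move: (liem c1 a) (liem c2 a) (liem c1 b) (liem c2 b) => s1 s2 s3 s4.
  by rewrite innerDl (innerC g a) innerDl (innerC g a) (innerC g a s4) addrACA.
have KZ r c' : K (r *: c') = r * K c'.
  by rewrite /K !liemZl innerZl ![inner g a _]innerC innerZl mulrDr.
have K0 : K 0 = 0 by rewrite -(scale0r 0) KZ mul0r.
rewrite -/(K c) {2}(row_sum_delta c) (big_morph K KD K0) mulr_sumr.
apply: eq_bigr => i _; rewrite KZ mxE -/(K _).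
have := weight_gt0 i gm => /gt_eqF/negbT w0.
by rewrite /K; field; rewrite ?w0.
Qed.

Lemma nomizu_torsion g a b : nomizu g a b - nomizu g b a = liem a b.
Proof.
rewrite /nomizu; have -> : Uterm g a b = Uterm g b a.
  apply: eq_mx => _ i.
  move: (liem (delta_mx 0 i) a) => s.
  move: (liem (delta_mx 0 i) b) => t.
  by rewrite addrC (innerC g a) (innerC g s).
rewrite (liemC b a); move: (liem a b) (Uterm g b a) => s t.
by apply/rowP => i; rewrite !mxE; field.
Qed.

Lemma nomizu_metric g a b c : inv_metric g ->
  inner g (nomizu g a b) c + inner g b (nomizu g a c) = 0.
Proof.
move=> gm; rewrite (innerC g b) /nomizu.
have := inner_Uterm a b c gm; have := inner_Uterm a c b gm.
rewrite (liemC c a) (liemC c b) (liemC b a).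
move: (Uterm g a b) (Uterm g a c) (liem a b) (liem a c) (liem b c).
move=> v w s t u Ew Ev.
rewrite !innerDl !innerZl Ew Ev !innerNl !innerNr ?(innerC g b t).
by ring.
Qed.

Local Notation o k := (@Ordinal 6 k isT).

Lemma half_complex : (2%:R^-1 : C) = Complex (2^-1) 0.
Proof.
apply: (mulfI (_ : 2%:R != 0 :> C)); rewrite ?pnatr_eq0//.
rewrite divff ?pnatr_eq0//; apply/eqP; rewrite eq_complex /=.
by apply/andP; split; apply/eqP; field.
Qed.

Lemma mmxE a : mmx a = \matrix_(i, j)
  nth 0 (nth [::] [::
    [:: 0; Complex (- (a 0 (o 0) / 2)) (a 0 (o 1) / 2);
        Complex (- (a 0 (o 2) / 2)) (a 0 (o 3) / 2)];
    [:: Complex (a 0 (o 0) / 2) (a 0 (o 1) / 2); 0;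
        Complex (- (a 0 (o 4) / 2)) (a 0 (o 5) / 2)];
    [:: Complex (a 0 (o 2) / 2) (a 0 (o 3) / 2);
        Complex (a 0 (o 4) / 2) (a 0 (o 5) / 2); 0]] i) j.
Proof.
have sum6 F : \sum_(i < 6) F i = F (o 0) + (F (o 1) + (F (o 2)
    + (F (o 3) + (F (o 4) + F (o 5))))) :> 'M[C]_3.
  rewrite !big_ord_recl big_ord0 addr0.
  by do ?congr (_ + _); congr F; apply: val_inj.
apply/matrixP => i j; rewrite /mmx sum6 /frame half_complex.
rewrite /tnth /= !mxE.
case: i => [[|[|[|//]]] Hi]; case: j => [[|[|[|//]]] Hj] /=;
  rewrite ?mulr0 ?mulr1 /=; apply/eqP; rewrite eq_complex /=;
  apply/andP; split; apply/eqP; by field.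
Qed.

Lemma mmxK : cancel mmx mpart.
Proof.
move=> a; apply/rowP => -[[|[|[|[|[|[|//]]]]]] Hi]; rewrite mmxE mxE /tnth /= !mxE /=.
all: rewrite mulrC divfK ?pnatr_eq0//; congr (a 0 _); exact: val_inj.
Qed.

Lemma su3_decomp X : (map_mx conjc X)^T = - X -> X = tpart X + mmx (mpart X).
Proof.
move=> /matrixP XE; rewrite mmxE; apply/matrixP => i j; rewrite !mxE.
have := XE i j; rewrite !mxE.
case: i => [[|[|[|//]]] Hi]; case: j => [[|[|[|//]]] Hj];
  rewrite /tnth /= ?mulr1n ?mulr0n ?addr0 ?add0r// => E.
1,2,4: rewrite -[LHS]opprK -E.
all: rewrite /i1 /i2 /i3 !(bool_irrelevance Hi isT) !(bool_irrelevance Hj isT).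
all: case: (X _ _) => s t; apply/eqP; rewrite eq_complex /=.
all: by apply/andP; split; apply/eqP; field.
Qed.

End Flag.
Arguments secRic : clear implicits.

(* Main.v *)
Require Import Defs.
From HB Require Import structures.
From mathcomp Require Import all_boot all_order all_algebra.
From mathcomp Require Import complex.
From mathcomp Require Import ring lra.
From mathcomp Require Import all_classical all_reals all_analysis.
Import Order.TTheory GRing.Theory Num.Theory numFieldNormedType.Exports.
Local Open Scope classical_set_scope.
Local Open Scope ring_scope.

(** Curvature.  Write a tangent vector as three complex numbers, one for each
    m_jk.  As the T^2-weights of the second exterior power of m are separated,
    the numerator q(v, w) of the sectional curvature is a combination of squares:
    the three symplectic forms om_i = Im(conj(v_i) w_i) and, for each pair i, j,
    the two components of the bivector v /\ w in m_i /\ m_j (one of whose weights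
    is the third root).  The cross terms om_i om_j are a matter of choice, by the
    Pluecker relations.
    - Ric_4(v; w_1, ..., w_4) = Ric(v) - K(v, w_5) for the fifth vector of the
      orthonormal basis.  With v, w_5 in the same m_i this forces the parameters
      x, y, z to satisfy the strict triangle inequalities.  Conversely, in the
      variables a, b, c with x = b + c, y = a + c, z = a + b, the form
      Ric(v) |w|^2 - q(v, w) is a sum of squares with positive coefficients.
    - Near (5/16, 5/16) on the diagonal x = y, q(v, w) is at least a small multiple
      of the squared area of (v, w), so all Ric_d are positive, while
      Ric_1, Ric_2, Ric_3 fail for x <= 5/18 and Ric_5 fails for x <= 1/8.

    Flow.  The field precomposed with a retraction onto the triangle is bounded
    and Lipschitz, hence has global solutions, which never leave the triangle;
    uniqueness is Gronwall's inequality.  The six functions x, y, z, 1 - 2x,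
    1 - 2y, 1 - 2z each satisfy f' = k f, so they keep their sign: this gives (b).
    On the diagonal x' = 2x (1 - 2x)(1 - 3x)(1 - 4x), so the solution through 5/16
    runs down to 1/4 and crosses 5/18, and the one through 3/16 runs to 0 in
    negative time and crosses 1/8: this gives (a). *)

Set Implicit Arguments.
Unset Strict Implicit.
Unset Printing Implicit Defensive.

Local Notation o k := (@Ordinal 6 k isT).

Lemma sum6E (V : nmodType) (F : 'I_6 -> V) :
  \sum_i F i = F (o 0) + F (o 1) + F (o 2) + F (o 3) + F (o 4) + F (o 5).
Proof.
rewrite !big_ord_recl big_ord0 addr0 !addrA.
by do ?congr (_ + _); congr F; apply: val_inj.
Qed.

Lemma sum3E (V : nmodType) (F : 'I_3 -> V) :
  \sum_i F i = F (@Ordinal 3 0 isT) + F (@Ordinal 3 1 isT) + F (@Ordinal 3 2 isT).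
Proof.
rewrite !big_ord_recl big_ord0 addr0 !addrA.
by do ?congr (_ + _); congr F; apply: val_inj.
Qed.

(** * Curvature of invariant metrics *)

Section Curvature.
Variable R : realType.
Implicit Types (g : R * R) (v w : vec R).

Definition row6 (a0 a1 a2 a3 a4 a5 : R) : vec R :=
  \row_i tnth [tuple a0; a1; a2; a3; a4; a5] i.

Lemma row6E a0 a1 a2 a3 a4 a5 :
  (row6 a0 a1 a2 a3 a4 a5 0 (o 0) = a0) * (row6 a0 a1 a2 a3 a4 a5 0 (o 1) = a1) *
  (row6 a0 a1 a2 a3 a4 a5 0 (o 2) = a2) * (row6 a0 a1 a2 a3 a4 a5 0 (o 3) = a3) *
  (row6 a0 a1 a2 a3 a4 a5 0 (o 4) = a4) * (row6 a0 a1 a2 a3 a4 a5 0 (o 5) = a5).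
Proof. by rewrite !mxE. Qed.

Lemma row6P (a : vec R) :
  a = row6 (a 0 (o 0)) (a 0 (o 1)) (a 0 (o 2)) (a 0 (o 3)) (a 0 (o 4)) (a 0 (o 5)).
Proof.
apply/rowP => -[[|[|[|[|[|[|//]]]]]] Hi]; rewrite mxE /tnth /=;
  congr (a 0 _); exact: val_inj.
Qed.

Lemma innerE g (a b : vec R) : inner g a b =
  g.1 * (a 0 (o 0) * b 0 (o 0) + a 0 (o 1) * b 0 (o 1))
  + g.2 * (a 0 (o 2) * b 0 (o 2) + a 0 (o 3) * b 0 (o 3))
  + (1 - g.1 - g.2) * (a 0 (o 4) * b 0 (o 4) + a 0 (o 5) * b 0 (o 5)).
Proof. rewrite /inner sum6E /weight /tnth /=; ring. Qed.

Lemma lieE (X Y : 'M[R[i]]_3) i j : lie X Y i j =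
  (X i (i1) * Y (i1) j + X i (i2) * Y (i2) j + X i (i3) * Y (i3) j)
  - (Y i (i1) * X (i1) j + Y i (i2) * X (i2) j + Y i (i3) * X (i3) j).
Proof. by rewrite /lie !mxE !sum3E. Qed.

Lemma tpartE (X : 'M[R[i]]_3) i j : tpart X i j = X i j *+ (i == j).
Proof. by rewrite mxE. Qed.

Lemma mmx_row a0 a1 a2 a3 a4 a5 (X := mmx (row6 a0 a1 a2 a3 a4 a5)) :
  (((X i1 i1 = Complex 0 0) * (X i2 i2 = Complex 0 0) * (X i3 i3 = Complex 0 0)) *
  ((X i1 i2 = Complex (- (a0 / 2)) (a1 / 2)) * (X i2 i1 = Complex (a0 / 2) (a1 / 2)) *
   (X i1 i3 = Complex (- (a2 / 2)) (a3 / 2)) * (X i3 i1 = Complex (a2 / 2) (a3 / 2)) *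
   (X i2 i3 = Complex (- (a4 / 2)) (a5 / 2)) * (X i3 i2 = Complex (a4 / 2) (a5 / 2))))%type.
Proof. by rewrite /X mmxE !mxE /tnth. Qed.

Lemma liem_row a0 a1 a2 a3 a4 a5 b0 b1 b2 b3 b4 b5 :
  liem (row6 a0 a1 a2 a3 a4 a5) (row6 b0 b1 b2 b3 b4 b5) =
  row6 ((a2 * b4 + a3 * b5 - a4 * b2 - a5 * b3) / 2)
       ((a3 * b4 - a2 * b5 - a4 * b3 + a5 * b2) / 2)
       ((a4 * b0 - a5 * b1 - a0 * b4 + a1 * b5) / 2)
       ((a4 * b1 + a5 * b0 - a0 * b5 - a1 * b4) / 2)
       ((a0 * b2 + a1 * b3 - a2 * b0 - a3 * b1) / 2)
       ((a0 * b3 - a1 * b2 + a2 * b1 - a3 * b0) / 2).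
Proof.
apply/rowP => i; rewrite [LHS]mxE [RHS]mxE !lieE !mmx_row.
case: i => [[|[|[|[|[|[|//]]]]]] Hi]; by rewrite /tnth /=; field.
Qed.

(** Brackets of two different summands lie in the third one, so only [m_i, m_i] reaches t, and it
    does so through the symplectic form om_i. *)
Lemma liet_row a0 a1 a2 a3 a4 a5 b0 b1 b2 b3 b4 b5
    (X := liet (row6 a0 a1 a2 a3 a4 a5) (row6 b0 b1 b2 b3 b4 b5))
    (om1 := a0 * b1 - a1 * b0) (om2 := a2 * b3 - a3 * b2) (om3 := a4 * b5 - a5 * b4) :
  ((X i1 i1 = Complex 0 (- (om1 + om2) / 2)) * (X i2 i2 = Complex 0 ((om1 - om3) / 2)) *
   (X i3 i3 = Complex 0 ((om2 + om3) / 2)) *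
   ((X i1 i2 = 0) * (X i2 i1 = 0) * (X i1 i3 = 0) * (X i3 i1 = 0) *
    (X i2 i3 = 0) * (X i3 i2 = 0)))%type.
Proof.
rewrite /X /liet !tpartE !mulr0n !mulr1n !lieE !mmx_row.
do ![split => //].
all: rewrite /om1 /om2 /om3; apply/eqP; rewrite eq_complex /=.
all: by apply/andP; split; apply/eqP; field.
Qed.

(** A diagonal matrix acts on m_jk by the root, the difference of its diagonal entries k and j. The
    numbers [t1], [t2], [t3] are the imaginary parts of these differences for [liet], whence three
    plane rotations. *)
Lemma isotropy_row a0 a1 a2 a3 a4 a5 b0 b1 b2 b3 b4 b5 c0 c1 c2 c3 c4 c5
    (om1 := a0 * b1 - a1 * b0) (om2 := a2 * b3 - a3 * b2) (om3 := a4 * b5 - a5 * b4)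
    (t1 := (2 * om1 + om2 - om3) / 2) (t2 := (om1 + 2 * om2 + om3) / 2)
    (t3 := (2 * om3 + om2 - om1) / 2) :
  mpart (lie (liet (row6 a0 a1 a2 a3 a4 a5) (row6 b0 b1 b2 b3 b4 b5))
             (mmx (row6 c0 c1 c2 c3 c4 c5))) =
  row6 (- (t1 * c1)) (t1 * c0) (- (t2 * c3)) (t2 * c2) (- (t3 * c5)) (t3 * c4).
Proof.
apply/rowP => i; rewrite [LHS]mxE [RHS]mxE !lieE !mmx_row !liet_row.
rewrite ?mulr0 ?mul0r ?addr0 ?add0r.
rewrite -/om1 -/om2 -/om3 /t1 /t2 /t3.
case: i => [[|[|[|[|[|[|//]]]]]] Hi]; by rewrite /tnth /=; field.
Qed.

Lemma delta_row6 :
  ((delta_mx 0 (o 0) = row6 1 0 0 0 0 0) * (delta_mx 0 (o 1) = row6 0 1 0 0 0 0) *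
  (delta_mx 0 (o 2) = row6 0 0 1 0 0 0) * (delta_mx 0 (o 3) = row6 0 0 0 1 0 0) *
  (delta_mx 0 (o 4) = row6 0 0 0 0 1 0) * (delta_mx 0 (o 5) = row6 0 0 0 0 0 1))%type.
Proof. by do ![split]; rewrite [LHS]row6P !mxE. Qed.

Lemma inner_row6 g a0 a1 a2 a3 a4 a5 b0 b1 b2 b3 b4 b5 :
  inner g (row6 a0 a1 a2 a3 a4 a5) (row6 b0 b1 b2 b3 b4 b5) =
  g.1 * (a0 * b0 + a1 * b1) + g.2 * (a2 * b2 + a3 * b3)
  + (1 - g.1 - g.2) * (a4 * b4 + a5 * b5).
Proof. by rewrite innerE !row6E. Qed.

Lemma row6D a0 a1 a2 a3 a4 a5 b0 b1 b2 b3 b4 b5 :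
  row6 a0 a1 a2 a3 a4 a5 + row6 b0 b1 b2 b3 b4 b5 =
  row6 (a0 + b0) (a1 + b1) (a2 + b2) (a3 + b3) (a4 + b4) (a5 + b5).
Proof. by rewrite [LHS]row6P !mxE. Qed.

Lemma row6Z k a0 a1 a2 a3 a4 a5 :
  k *: row6 a0 a1 a2 a3 a4 a5 = row6 (k * a0) (k * a1) (k * a2) (k * a3) (k * a4) (k * a5).
Proof. by rewrite [LHS]row6P !mxE. Qed.

(* [nomizu] maps m_i x m_j to m_k as the bracket multiplied by twice this factor. *)
Definition kfactor (xi xj xk : R) := (xk + xj - xi) / (4 * xk).

Lemma nomizu_row g a0 a1 a2 a3 a4 a5 b0 b1 b2 b3 b4 b5
  (x := g.1) (y := g.2) (z := 1 - g.1 - g.2) : inv_metric g ->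
  nomizu g (row6 a0 a1 a2 a3 a4 a5) (row6 b0 b1 b2 b3 b4 b5) =
  row6 ((a2 * b4 + a3 * b5) * kfactor y z x - (a4 * b2 + a5 * b3) * kfactor z y x)
       ((a3 * b4 - a2 * b5) * kfactor y z x - (a4 * b3 - a5 * b2) * kfactor z y x)
       ((a4 * b0 - a5 * b1) * kfactor z x y - (a0 * b4 - a1 * b5) * kfactor x z y)
       ((a4 * b1 + a5 * b0) * kfactor z x y - (a0 * b5 + a1 * b4) * kfactor x z y)
       ((a0 * b2 + a1 * b3) * kfactor x y z - (a2 * b0 + a3 * b1) * kfactor y x z)
       ((a0 * b3 - a1 * b2) * kfactor x y z - (a3 * b0 - a2 * b1) * kfactor y x z).
Proof.
move=> [x0 y0 z0'].
have z0 : 0 < z by rewrite /z; lra.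
have [xn yn zn] : [/\ x != 0, y != 0 & z != 0] by rewrite !gt_eqF.
rewrite /nomizu; have -> : forall v w, Uterm g v w = row6
   ((inner g (liem (delta_mx 0 (o 0)) v) w
      + inner g v (liem (delta_mx 0 (o 0)) w)) / (2 * x))
   ((inner g (liem (delta_mx 0 (o 1)) v) w
      + inner g v (liem (delta_mx 0 (o 1)) w)) / (2 * x))
   ((inner g (liem (delta_mx 0 (o 2)) v) w
      + inner g v (liem (delta_mx 0 (o 2)) w)) / (2 * y))
   ((inner g (liem (delta_mx 0 (o 3)) v) w
      + inner g v (liem (delta_mx 0 (o 3)) w)) / (2 * y))
   ((inner g (liem (delta_mx 0 (o 4)) v) w
      + inner g v (liem (delta_mx 0 (o 4)) w)) / (2 * z))
   ((inner g (liem (delta_mx 0 (o 5)) v) w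
      + inner g v (liem (delta_mx 0 (o 5)) w)) / (2 * z)).
  move=> v w; rewrite [LHS]row6P; congr row6; by rewrite [LHS]mxE.
rewrite !delta_row6 !liem_row !inner_row6 row6Z row6D -/z -/x -/y /kfactor.
by congr row6; field; rewrite ?xn ?yn ?zn.
Qed.

Lemma row6N (a0 a1 a2 a3 a4 a5 : R) :
  - row6 a0 a1 a2 a3 a4 a5 = row6 (- a0) (- a1) (- a2) (- a3) (- a4) (- a5).
Proof. by rewrite [LHS]row6P !mxE. Qed.

(* Coefficients of the two weight components of m_i /\ m_j, normalized so that no
   product of two different symplectic forms occurs in [sform]. *)
Definition root_coef (xi xj xk : R) :=
  (4 * xk * (xi + xj) - (xi - xj) ^+ 2 - 3 * xk ^+ 2) / (16 * xk).
Definition nonroot_coef (xi xj xk : R) := ((xi - xj) ^+ 2 - xk * (xi + xj)) / (8 * xk).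

Definition sform (x y z : R) v w : R :=
  let: (a0, a1, a2) := (v 0 (o 0), v 0 (o 1), v 0 (o 2)) in
  let: (a3, a4, a5) := (v 0 (o 3), v 0 (o 4), v 0 (o 5)) in
  let: (b0, b1, b2) := (w 0 (o 0), w 0 (o 1), w 0 (o 2)) in
  let: (b3, b4, b5) := (w 0 (o 3), w 0 (o 4), w 0 (o 5)) in
  x * (a0 * b1 - a1 * b0) ^+ 2 + y * (a2 * b3 - a3 * b2) ^+ 2
  + z * (a4 * b5 - a5 * b4) ^+ 2
  + root_coef x y z * ((a0 * b2 + a1 * b3 - a2 * b0 - a3 * b1) ^+ 2
                 + (a0 * b3 - a1 * b2 + a2 * b1 - a3 * b0) ^+ 2)
  + nonroot_coef x y z * ((a0 * b2 - a1 * b3 - a2 * b0 + a3 * b1) ^+ 2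
                 + (a0 * b3 + a1 * b2 - a2 * b1 - a3 * b0) ^+ 2)
  + root_coef x z y * ((a4 * b0 - a5 * b1 - a0 * b4 + a1 * b5) ^+ 2
                 + (a4 * b1 + a5 * b0 - a0 * b5 - a1 * b4) ^+ 2)
  + nonroot_coef x z y * ((a0 * b4 + a1 * b5 - a4 * b0 - a5 * b1) ^+ 2
                 + (a0 * b5 - a1 * b4 + a4 * b1 - a5 * b0) ^+ 2)
  + root_coef y z x * ((a2 * b4 + a3 * b5 - a4 * b2 - a5 * b3) ^+ 2
                 + (a3 * b4 - a2 * b5 - a4 * b3 + a5 * b2) ^+ 2)
  + nonroot_coef y z x * ((a2 * b4 - a3 * b5 - a4 * b2 + a5 * b3) ^+ 2
                 + (a3 * b4 + a2 * b5 - a4 * b3 - a5 * b2) ^+ 2).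

Lemma curvature_form g v w : inv_metric g ->
  inner g (curvature g v w w) v = sform g.1 g.2 (1 - g.1 - g.2) v w.
Proof.
move=> gm; have [x0 y0 z0'] := gm.
have z0 : 0 < 1 - g.1 - g.2 by lra.
rewrite (row6P v) (row6P w) /sform !row6E.
move: (v 0 (o 0)) (v 0 (o 1)) (v 0 (o 2))
  (v 0 (o 3)) (v 0 (o 4)) (v 0 (o 5)) => a0 a1 a2 a3 a4 a5.
move: (w 0 (o 0)) (w 0 (o 1)) (w 0 (o 2))
  (w 0 (o 3)) (w 0 (o 4)) (w 0 (o 5)) => b0 b1 b2 b3 b4 b5.
rewrite /curvature !liem_row isotropy_row !nomizu_row // !row6N !row6D inner_row6.
move: x0 y0 z0; rewrite /kfactor /root_coef /nonroot_coef {z0' gm}.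
(* The third parameter is abstracted along with the other two: [field] proves an identity of
   rational functions in independent x, y, z. *)
move: g.1 g.2 (1 - _ - _) => x y z /gt_eqF xn /gt_eqF yn /gt_eqF zn.
by field; rewrite ?xn ?yn ?zn.
Qed.

End Curvature.

(** * Ricci tensor and sums of sectional curvatures over orthonormal families *)

Section Ricci.
Variable R : realType.
Implicit Types (g : R * R) (v w : vec R).

(* The Ricci tensor is diagonal with one eigenvalue on each m_i. *)
Definition ricform (x y z : R) v : R :=
  (6 * y * z + x ^+ 2 - y ^+ 2 - z ^+ 2) / (4 * y * z)
    * (v 0 (o 0) ^+ 2 + v 0 (o 1) ^+ 2)
  + (6 * x * z + y ^+ 2 - x ^+ 2 - z ^+ 2) / (4 * x * z)
    * (v 0 (o 2) ^+ 2 + v 0 (o 3) ^+ 2)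
  + (6 * x * y + z ^+ 2 - x ^+ 2 - y ^+ 2) / (4 * x * y)
    * (v 0 (o 4) ^+ 2 + v 0 (o 5) ^+ 2).

Definition lform (l w : vec R) : R := \sum_k l 0 k * w 0 k.

Lemma lform_row6 l0 l1 l2 l3 l4 l5 w : lform (row6 l0 l1 l2 l3 l4 l5) w =
  l0 * w 0 (o 0) + l1 * w 0 (o 1) + l2 * w 0 (o 2) + l3 * w 0 (o 3)
  + l4 * w 0 (o 4) + l5 * w 0 (o 5).
Proof. by rewrite /lform sum6E !row6E. Qed.

(** For fixed v every square in [sform] is the square of a linear form in w, the shape in which a
    trace over an orthonormal basis can be taken. *)
Lemma sform_lform x y z a0 a1 a2 a3 a4 a5 w :
  sform x y z (row6 a0 a1 a2 a3 a4 a5) w =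
  x * lform (row6 (- a1) a0 0 0 0 0) w ^+ 2
  + y * lform (row6 0 0 (- a3) a2 0 0) w ^+ 2
  + z * lform (row6 0 0 0 0 (- a5) a4) w ^+ 2
  + root_coef x y z * (lform (row6 (- a2) (- a3) a0 a1 0 0) w ^+ 2
               + lform (row6 (- a3) a2 (- a1) a0 0 0) w ^+ 2)
  + nonroot_coef x y z * (lform (row6 (- a2) a3 a0 (- a1) 0 0) w ^+ 2
               + lform (row6 (- a3) (- a2) a1 a0 0 0) w ^+ 2)
  + root_coef x z y * (lform (row6 a4 (- a5) 0 0 (- a0) a1) w ^+ 2
               + lform (row6 a5 a4 0 0 (- a1) (- a0)) w ^+ 2)
  + nonroot_coef x z y * (lform (row6 (- a4) (- a5) 0 0 a0 a1) w ^+ 2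
               + lform (row6 (- a5) a4 0 0 (- a1) a0) w ^+ 2)
  + root_coef y z x * (lform (row6 0 0 (- a4) (- a5) a2 a3) w ^+ 2
               + lform (row6 0 0 a5 (- a4) a3 (- a2)) w ^+ 2)
  + nonroot_coef y z x * (lform (row6 0 0 (- a4) a5 a2 (- a3)) w ^+ 2
               + lform (row6 0 0 (- a5) (- a4) a3 a2) w ^+ 2).
Proof.
rewrite /sform !lform_row6 !row6E.
by do !congr (_ + _); congr (_ * _); rewrite ?mul0r ?addr0 ?add0r;
  try congr (_ + _); congr (_ ^+ 2); ring.
Qed.

(** Orthonormality says that [D] is a right inverse of the square matrix [A]; it is then also a left
    inverse, and the entries of D A = 1 are the claim. *)
Lemma parseval g (W : 'I_6 -> vec R) k l : inv_metric g ->
  (forall i j, inner g (W i) (W j) = (i == j)%:R) ->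
  \sum_b W b 0 k * W b 0 l = (k == l)%:R / weight g k.
Proof.
move=> gm ortho.
pose A := \matrix_(b < 6, i < 6) W b 0 i.
pose D := \matrix_(i < 6, b < 6) (weight g i * W b 0 i).
have AD : A *m D = 1%:M.
  apply/matrixP => i j; rewrite !mxE -ortho; apply: eq_bigr => b _.
  by rewrite !mxE mulrCA mulrA.
have /matrixP/(_ k l) := mulmx1C AD; rewrite !mxE => <-.
under [in RHS]eq_bigr do rewrite !mxE -mulrA.
have := weight_gt0 k gm => /gt_eqF/negbT w0.
by rewrite -mulr_sumr mulrC mulKf.
Qed.

(** Both sides are the squared dual norm of the linear form, since the metric is diagonal in the
    frame. *)
Lemma parseval_lform g (W : 'I_6 -> vec R) l : inv_metric g ->
  (forall i j, inner g (W i) (W j) = (i == j)%:R) ->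
  \sum_b lform l (W b) ^+ 2 = \sum_k l 0 k ^+ 2 / weight g k.
Proof.
move=> gm ortho.
transitivity (\sum_k \sum_m l 0 k * l 0 m * \sum_b W b 0 k * W b 0 m).
  under [RHS]eq_bigr do under eq_bigr do rewrite mulr_sumr.
  under [RHS]eq_bigr do rewrite exchange_big /=.
  rewrite exchange_big /=; apply: eq_bigr => b _.
  rewrite expr2 /lform mulr_suml; apply: eq_bigr => k _.
  by rewrite mulr_sumr; apply: eq_bigr => m _; rewrite mulrACA.
apply: eq_bigr => k _; rewrite (bigD1 k) //= (parseval _ _ gm ortho) eqxx big1 => [|m].
  by rewrite addr0 mul1r expr2.
by rewrite (parseval _ _ gm ortho) eq_sym => /negbTE ->; rewrite mul0r mulr0.
Qed.

Lemma ricci_trace g (W : 'I_6 -> vec R) v : inv_metric g ->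
  (forall i j, inner g (W i) (W j) = (i == j)%:R) ->
  \sum_b sform g.1 g.2 (1 - g.1 - g.2) v (W b) = ricform g.1 g.2 (1 - g.1 - g.2) v.
Proof.
move=> gm ortho.
rewrite (row6P v); under eq_bigr do rewrite sform_lform.
rewrite !big_split -!mulr_sumr !big_split /= !(parseval_lform _ gm ortho).
have [x0 y0 z0'] := gm; have z0 : 0 < 1 - g.1 - g.2 by lra.
rewrite !sum6E !row6E /weight /tnth /= /ricform !row6E.
move: (v 0 (o 0)) (v 0 (o 1)) (v 0 (o 2))
  (v 0 (o 3)) (v 0 (o 4)) (v 0 (o 5)) => a0 a1 a2 a3 a4 a5.
move: x0 y0 z0; rewrite /root_coef /nonroot_coef {z0' gm ortho}.
move: g.1 g.2 (1 - _ - _) => x y z /gt_eqF xn /gt_eqF yn /gt_eqF zn.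
by field; rewrite ?xn ?yn ?zn.
Qed.

Lemma inner_ge0 g v : inv_metric g -> 0 <= inner g v v.
Proof.
move=> gm; apply: sumr_ge0 => i _; rewrite -mulrA mulr_ge0 ?sqr_ge0 //.
exact/ltW/weight_gt0.
Qed.

Lemma inner_eq0 g v : inv_metric g -> inner g v v = 0 -> v = 0.
Proof.
move=> gm /eqP; rewrite psumr_eq0 => [/allP H|i _]; last first.
  by rewrite -mulrA mulr_ge0 ?sqr_ge0 //; exact/ltW/weight_gt0.
apply/rowP => i; have := H i (mem_index_enum _); rewrite /= -mulrA !mulf_eq0.
by rewrite gt_eqF ?weight_gt0 //= orbb mxE => /eqP.
Qed.

(** Orthogonality to n vectors is a linear system with fewer equations than unknowns; a nonzero
    solution is normalized. *)
Lemma exists_orthogonal g n (W : 'I_n -> vec R) : inv_metric g -> (n < 6)%N ->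
  exists u, inner g u u = 1 /\ forall i, inner g u (W i) = 0.
Proof.
move=> gm n6.
pose A := \matrix_(k < 6, b < n) (weight g k * W b 0 k).
have : kermx A != 0.
  rewrite -mxrank_eq0 mxrank_ker subn_eq0 -ltnNge.
  exact: leq_ltn_trans (rank_leq_col A) n6.
case/rowV0Pn => u /sub_kermxP uA u0.
have u_pos : 0 < inner g u u.
  rewrite lt_neqAle inner_ge0 // andbT eq_sym; apply: contra u0 => /eqP.
  by move/(inner_eq0 gm)->.
exists ((Num.sqrt (inner g u u))^-1 *: u); split.
  rewrite innerZl innerC innerZl mulrA -expr2 exprVn sqr_sqrtr ?ltW //.
  by rewrite mulVf ?gt_eqF.
move=> i; rewrite innerZl; move/matrixP/(_ 0 i): uA; rewrite !mxE.
rewrite (_ : \sum_j _ = inner g u (W i)) => [->|]; first by rewrite mulr0.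
by apply: eq_bigr => k _; rewrite !mxE mulrCA mulrA.
Qed.

(** The expression [oapp w v (unlift ord0 i)] encodes the family w with v put in front, at index
    0. *)
Lemma orthonormal_cons g n v (w : 'I_n -> vec R) : Defs.orthonormal g v w ->
  forall i j : 'I_n.+1, inner g (oapp w v (unlift ord0 i)) (oapp w v (unlift ord0 j))
    = (i == j)%:R.
Proof.
move=> [vv vw ww] i j.
case: (unliftP ord0 i) => [i'|] ->; case: (unliftP ord0 j) => [j'|] -> /=;
  rewrite ?liftK ?unlift_none /=.
- by rewrite ww (inj_eq (@lift_inj _ _)).
- by rewrite innerC vw.
- by rewrite vw.
- by rewrite vv.
Qed.

Lemma sform_self x y z v : sform x y z v v = 0.
Proof. rewrite /sform; ring. Qed.

Lemma Ric_sform g d v (w : 'I_d -> vec R) : inv_metric g -> Defs.orthonormal g v w ->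
  Ric g v w = \sum_(i < d) sform g.1 g.2 (1 - g.1 - g.2) v (w i).
Proof.
move=> gm [vv vw ww]; apply: eq_bigr => i _.
by rewrite /sectional curvature_form // vv vw ww eqxx expr0n subr0 mulr1 divr1.
Qed.

Lemma Ric5 g v (w : 'I_5 -> vec R) : inv_metric g -> Defs.orthonormal g v w ->
  Ric g v w = ricform g.1 g.2 (1 - g.1 - g.2) v.
Proof.
move=> gm vw; rewrite Ric_sform // -(ricci_trace v gm (orthonormal_cons vw)).
rewrite [RHS]big_ord_recl unlift_none /= sform_self add0r.
by apply: eq_bigr => i _; rewrite liftK.
Qed.

Lemma Ric4 g v (w : 'I_4 -> vec R) : inv_metric g -> Defs.orthonormal g v w ->
  exists u, [/\ inner g u u = 1, inner g v u = 0 & Ric g v w =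
    ricform g.1 g.2 (1 - g.1 - g.2) v - sform g.1 g.2 (1 - g.1 - g.2) v u].
Proof.
move=> gm vw; have vw_cons := orthonormal_cons vw.
have [u [uu uw]] := exists_orthogonal (fun i : 'I_5 => oapp w v (unlift ord0 i)) gm isT.
have uv : inner g v u = 0 by have := uw ord0; rewrite unlift_none innerC.
exists u; split => //.
(* Now [u] is put in front of [w], so that [Ric5] applies to these five vectors and the term of [u]
   can be split off. *)
have H : Defs.orthonormal g v (fun i : 'I_5 => oapp w u (unlift ord0 i)).
  case: (vw) => vv vwi ww; split => // [i|].
    by case: (unliftP ord0 i) => [i'|] _ /=.
  apply: (@orthonormal_cons _ _ u w); split => // i.
  by have := uw (lift ord0 i); rewrite liftK.
rewrite -(Ric5 gm H) !Ric_sform // [X in _ = X - _]big_ord_recl unlift_none /=.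
rewrite [RHS]addrAC subrr add0r.
by apply: eq_bigr => i _; rewrite liftK.
Qed.

End Ricci.

(** * The triangle inequalities and positivity of Ric_4; test vectors from the frame *)

Section Positivity.
Variable R : realType.
Implicit Types (g : R * R) (v w : vec R).

Lemma exists_pos_of_weighted_sum (x y z n1 n2 n3 : R) : 0 <= n1 -> 0 <= n2 -> 0 <= n3 ->
  0 < x * n1 + y * n2 + z * n3 -> [\/ 0 < n1, 0 < n2 | 0 < n3].
Proof.
rewrite !le_eqVlt => /orP[/eqP<-|?]; last by constructor 1.
move=> /orP[/eqP<-|?]; last by constructor 2.
move=> /orP[/eqP<-|?]; last by constructor 3.
by rewrite !mulr0 !addr0 ltxx.
Qed.

Lemma bilinear_gt0 (c11 c12 c13 c21 c22 c23 c31 c32 c33 n1 n2 n3 m1 m2 m3 : R) :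
  0 < c11 -> 0 < c12 -> 0 < c13 -> 0 < c21 -> 0 < c22 -> 0 < c23 ->
  0 < c31 -> 0 < c32 -> 0 < c33 ->
  0 <= n1 -> 0 <= n2 -> 0 <= n3 -> 0 <= m1 -> 0 <= m2 -> 0 <= m3 ->
  [\/ 0 < n1, 0 < n2 | 0 < n3] -> [\/ 0 < m1, 0 < m2 | 0 < m3] ->
  0 < c11 * (n1 * m1) + c12 * (n1 * m2) + c13 * (n1 * m3)
    + c21 * (n2 * m1) + c22 * (n2 * m2) + c23 * (n2 * m3)
    + c31 * (n3 * m1) + c32 * (n3 * m2) + c33 * (n3 * m3).
Proof.
move=> ? ? ? ? ? ? ? ? ? n10 n20 n30 m10 m20 m30 n0 m0.
have nm (c n m : R) : 0 < c -> 0 <= n -> 0 <= m -> 0 <= c * (n * m).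
  by move=> /ltW c0 ? ?; rewrite !mulr_ge0.
have nm' (c n m : R) : 0 < c -> 0 < n -> 0 < m -> 0 < c * (n * m).
  by move=> c0 ? ?; rewrite !mulr_gt0.
have := nm c11 n1 m1; have := nm c12 n1 m2; have := nm c13 n1 m3.
have := nm c21 n2 m1; have := nm c22 n2 m2; have := nm c23 n2 m3.
have := nm c31 n3 m1; have := nm c32 n3 m2; have := nm c33 n3 m3.
do 9 (move=> /(_ ltac:(assumption) ltac:(assumption) ltac:(assumption)) ?).
case: n0 => n0; case: m0 => m0.
- have := nm' c11 n1 m1 ltac:(assumption) n0 m0; lra.
- have := nm' c12 n1 m2 ltac:(assumption) n0 m0; lra.
- have := nm' c13 n1 m3 ltac:(assumption) n0 m0; lra.
- have := nm' c21 n2 m1 ltac:(assumption) n0 m0; lra.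
- have := nm' c22 n2 m2 ltac:(assumption) n0 m0; lra.
- have := nm' c23 n2 m3 ltac:(assumption) n0 m0; lra.
- have := nm' c31 n3 m1 ltac:(assumption) n0 m0; lra.
- have := nm' c32 n3 m2 ltac:(assumption) n0 m0; lra.
- have := nm' c33 n3 m3 ltac:(assumption) n0 m0; lra.
Qed.

(* [a], [b], [c] are the slacks of the triangle inequalities. *)
Lemma sform_lt_ricform (a b c : R) v w : 0 < a -> 0 < b -> 0 < c ->
  let I u := (b + c) * (u 0 (o 0) ^+ 2 + u 0 (o 1) ^+ 2)
    + (a + c) * (u 0 (o 2) ^+ 2 + u 0 (o 3) ^+ 2)
    + (a + b) * (u 0 (o 4) ^+ 2 + u 0 (o 5) ^+ 2) : R in
  0 < I v -> 0 < I w ->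
  sform (b + c) (a + c) (a + b) v w < ricform (b + c) (a + c) (a + b) v * I w.
Proof.
have sq (r s : R) : 0 <= r ^+ 2 + s ^+ 2 by rewrite addr_ge0 ?sqr_ge0.
move=> a0 b0 c0 /= /(exists_pos_of_weighted_sum (sq _ _) (sq _ _) (sq _ _)) nv.
move=> /(exists_pos_of_weighted_sum (sq _ _) (sq _ _) (sq _ _)) nw.
move: nv nw; rewrite /sform /ricform.
move: (v 0 (o 0)) (v 0 (o 1)) (v 0 (o 2))
  (v 0 (o 3)) (v 0 (o 4)) (v 0 (o 5)) => p0 p1 p2 p3 p4 p5.
move: (w 0 (o 0)) (w 0 (o 1)) (w 0 (o 2))
  (w 0 (o 3)) (w 0 (o 4)) (w 0 (o 5)) => q0 q1 q2 q3 q4 q5.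
move=> nv nw.
have x0 : 0 < b + c by lra.
have y0 : 0 < a + c by lra.
have z0 : 0 < a + b by lra.
set X := b + c in x0 nv nw *; set Y := a + c in y0 nv nw *; set Z := a + b in z0 nv nw *.
pose e := a * b + b * c + c * a.
pose k12 := a * c + b * c - a * b.
pose k13 := a * b + b * c - a * c.
pose k23 := a * b + a * c - b * c.
(* [Q + B] is the difference of the two sides multiplied by [4 X Y Z]. *)
pose Q : R :=
   X ^+ 2 * (4 * (a ^+ 2 + e) * (p0 * q0 + p1 * q1) ^+ 2)
 + Y ^+ 2 * (4 * (b ^+ 2 + e) * (p2 * q2 + p3 * q3) ^+ 2)
 + Z ^+ 2 * (4 * (c ^+ 2 + e) * (p4 * q4 + p5 * q5) ^+ 2)
 + X * Y * ((3 * e + k12) / 2 * ((p0 * q2 + p1 * q3 + p2 * q0 + p3 * q1) ^+ 2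
                 + (p0 * q3 - p1 * q2 - p2 * q1 + p3 * q0) ^+ 2)
          + (3 * e - k12) / 2 * ((p0 * q2 - p1 * q3 - p2 * q0 + p3 * q1) ^+ 2
                 + (p0 * q3 + p1 * q2 - p2 * q1 - p3 * q0) ^+ 2))
 + X * Z * ((3 * e + k13) / 2 * ((p4 * q0 - p5 * q1 + p0 * q4 - p1 * q5) ^+ 2
                 + (p4 * q1 + p5 * q0 + p0 * q5 + p1 * q4) ^+ 2)
          + (3 * e - k13) / 2 * ((p0 * q4 + p1 * q5 - p4 * q0 - p5 * q1) ^+ 2
                 + (p0 * q5 - p1 * q4 + p4 * q1 - p5 * q0) ^+ 2))
 + Y * Z * ((3 * e + k23) / 2 * ((p2 * q4 + p3 * q5 + p4 * q2 + p5 * q3) ^+ 2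
                 + (p3 * q4 - p2 * q5 + p4 * q3 - p5 * q2) ^+ 2)
          + (3 * e - k23) / 2 * ((p2 * q4 - p3 * q5 - p4 * q2 + p5 * q3) ^+ 2
                 + (p3 * q4 + p2 * q5 - p4 * q3 - p5 * q2) ^+ 2)).
have e0 : 0 < e by rewrite /e !addr_gt0 ?mulr_gt0.
have [ab0 bc0 ac0] : [/\ 0 < a * b, 0 < b * c & 0 < a * c] by rewrite !mulr_gt0.
have a20 : 0 < a ^+ 2 by rewrite exprn_gt0.
have b20 : 0 < b ^+ 2 by rewrite exprn_gt0.
have c20 : 0 < c ^+ 2 by rewrite exprn_gt0.
have [X20 Y20 Z20] : [/\ 0 < X ^+ 2, 0 < Y ^+ 2 & 0 < Z ^+ 2] by rewrite !exprn_gt0.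
have [XY0 XZ0 YZ0] : [/\ 0 < X * Y, 0 < X * Z & 0 < Y * Z] by rewrite !mulr_gt0.
(* Each [k_ij] is [e] minus twice one of the products [a * b], [b * c], [c * a], so [3 * e + k_ij]
   and [3 * e - k_ij] are both positive. *)
have Q0 : 0 <= Q.
{   apply: (addr_ge0 (addr_ge0 (addr_ge0 (addr_ge0 (addr_ge0 _ _) _) _) _) _).
  1-3: by apply: mulr_ge0; [exact: ltW | apply: mulr_ge0; [lra | exact: sqr_ge0]].
  all: apply: mulr_ge0; [exact: ltW | apply: addr_ge0; apply: mulr_ge0 => //].
  all: by rewrite /k12 /k13 /k23 /e; lra.
}
(* The strict part: all nine products of a squared component norm of v with one of w occur with a
   positive coefficient, and v and w each have a nonzero component. *)
pose B : R := X ^+ 2 * (4 * (b * c)) * ((p0 ^+ 2 + p1 ^+ 2) * (q0 ^+ 2 + q1 ^+ 2))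
  + X * Y * (4 * a ^+ 2 + 2 * (a * b) + 4 * (b * c))
    * ((p0 ^+ 2 + p1 ^+ 2) * (q2 ^+ 2 + q3 ^+ 2))
  + X * Z * (4 * a ^+ 2 + 2 * (a * c) + 4 * (b * c))
    * ((p0 ^+ 2 + p1 ^+ 2) * (q4 ^+ 2 + q5 ^+ 2))
  + X * Y * (4 * b ^+ 2 + 2 * (a * b) + 4 * (a * c))
    * ((p2 ^+ 2 + p3 ^+ 2) * (q0 ^+ 2 + q1 ^+ 2))
  + Y ^+ 2 * (4 * (a * c)) * ((p2 ^+ 2 + p3 ^+ 2) * (q2 ^+ 2 + q3 ^+ 2))
  + Y * Z * (4 * b ^+ 2 + 2 * (b * c) + 4 * (a * c))
    * ((p2 ^+ 2 + p3 ^+ 2) * (q4 ^+ 2 + q5 ^+ 2))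
  + X * Z * (4 * c ^+ 2 + 2 * (a * c) + 4 * (a * b))
    * ((p4 ^+ 2 + p5 ^+ 2) * (q0 ^+ 2 + q1 ^+ 2))
  + Y * Z * (4 * c ^+ 2 + 2 * (b * c) + 4 * (a * b))
    * ((p4 ^+ 2 + p5 ^+ 2) * (q2 ^+ 2 + q3 ^+ 2))
  + Z ^+ 2 * (4 * (a * b)) * ((p4 ^+ 2 + p5 ^+ 2) * (q4 ^+ 2 + q5 ^+ 2)).
have B0 : 0 < B.
  by apply: bilinear_gt0; rewrite ?addr_ge0 ?sqr_ge0 // ?mulr_gt0 ?addr_gt0 ?mulr_gt0.
rewrite -subr_gt0.
have XYZ0 : 0 < 4 * X * Y * Z by rewrite !mulr_gt0.
rewrite -(pmulr_rgt0 _ XYZ0).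
rewrite [ltRHS](_ : _ = Q + B); first by rewrite ltr_wpDl.
move: x0 y0 z0 => /gt_eqF xn /gt_eqF yn /gt_eqF zn.
rewrite /Q /B /root_coef /nonroot_coef /k12 /k13 /k23 /e.
move: xn yn zn; rewrite /X /Y /Z => xn yn zn.
by field; rewrite ?xn ?yn ?zn.
Qed.

(** As x + y + z = 1, the condition x < 1/2 reads x < y + z. The set consists of the metrics
    satisfying the strict triangle inequalities and is the open triangle on the midpoints of the
    edges of the parameter triangle. *)
Definition medial : set (R * R) :=
  [set g | [/\ g.1 < 2^-1, g.2 < 2^-1 & 2^-1 < g.1 + g.2]].

Lemma medial_inv_metric g : medial g -> inv_metric g.
Proof. by case=> x1 y1 xy1; split; lra. Qed.

Lemma medial_secRic4 g : medial g -> secRic R 4 g.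
Proof.
move=> gmed; have gm := medial_inv_metric gmed; have [x1 y1 xy1] := gmed.
split=> // v w vw; have [u [uu vu ->]] := Ric4 gm vw.
have [vv _ _] := vw.
have a0 : 0 < 2^-1 - g.1 by lra.
have b0 : 0 < 2^-1 - g.2 by lra.
have c0 : 0 < g.1 + g.2 - 2^-1 by lra.
have := @sform_lt_ricform (2^-1 - g.1) (2^-1 - g.2) (g.1 + g.2 - 2^-1) v u a0 b0 c0.
have -> : 2^-1 - g.2 + (g.1 + g.2 - 2^-1) = g.1 by ring.
have -> : 2^-1 - g.1 + (g.1 + g.2 - 2^-1) = g.2 by ring.
have -> : 2^-1 - g.1 + (2^-1 - g.2) = 1 - g.1 - g.2 by field.
have innerEsq (a : vec R) : g.1 * (a 0 (o 0) ^+ 2 + a 0 (o 1) ^+ 2)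
    + g.2 * (a 0 (o 2) ^+ 2 + a 0 (o 3) ^+ 2)
    + (1 - g.1 - g.2) * (a 0 (o 4) ^+ 2 + a 0 (o 5) ^+ 2) = inner g a a.
  by rewrite innerE; ring.
by rewrite /= !innerEsq vv uu mulr1 subr_gt0; apply.
Qed.

Lemma sformZr x y z v (c : R) w : sform x y z v (c *: w) = c ^+ 2 * sform x y z v w.
Proof. by rewrite /sform !mxE; ring. Qed.

Lemma sformC x y z v w : sform x y z v w = sform x y z w v.
Proof. by rewrite /sform; ring. Qed.

Lemma inner_delta g i j : inner g (delta_mx 0 i) (delta_mx 0 j) = weight g i *+ (i == j).
Proof.
rewrite /inner (bigD1 i) //= big1 => [|k /negbTE ki]; rewrite !mxE ?eqxx ?ki /=.
  by rewrite addr0 mulr1; case: (i == j); rewrite ?mulr1 ?mulr0.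
by rewrite mulr0 mul0r.
Qed.

(** Necessary conditions come from frame vectors scaled to unit length. The common factor
    [(weight g i)^-1] is positive and is dropped. *)
Lemma secRic_frame g d (i : 'I_6) (s : d.-tuple 'I_6) : secRic R d g -> uniq (i :: s) ->
  0 < \sum_(j <- s) sform g.1 g.2 (1 - g.1 - g.2) (delta_mx 0 i) (delta_mx 0 j) / weight g j.
Proof.
move=> [gm sec] /= /andP[is_ us].
pose e j : vec R := (Num.sqrt (weight g j))^-1 *: delta_mx 0 j.
have sq j : (Num.sqrt (weight g j))^-1 ^+ 2 = (weight g j)^-1.
  by rewrite exprVn sqr_sqrtr // ltW // weight_gt0.
have ee j k : inner g (e j) (e k) = (j == k)%:R.
  rewrite innerZl innerC innerZl inner_delta.
  case: (altP (k =P j)) => [->|]; last by rewrite eq_sym => /negbTE ->; rewrite !mulr0.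
  by rewrite eqxx mulr1n mulrA -expr2 sq mulVf ?gt_eqF ?weight_gt0.
have : Defs.orthonormal g (e i) (fun k => e (tnth s k)).
  split=> [|k|k l]; rewrite ee ?eqxx //.
    by case: eqP => // E; rewrite E mem_tnth in is_.
  by rewrite (inj_eq (tuple_uniqP _ us)).
move=> es; have := sec _ _ es; rewrite (Ric_sform gm es) big_tuple.
rewrite (eq_bigr (fun k => (weight g i)^-1 *
  (sform g.1 g.2 (1 - g.1 - g.2) (delta_mx 0 i) (delta_mx 0 (tnth s k))
   / weight g (tnth s k)))) => [|k _].
  by rewrite -mulr_sumr pmulr_rgt0 ?invr_gt0 ?weight_gt0.
by rewrite /e sformZr sformC sformZr sformC !sq mulrCA [_^-1 * sform _ _ _ _ _]mulrC.
Qed.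

End Positivity.

(** * Positive Ric_4, positive Ric_5, and the metrics on the diagonal x = y *)

Section Regions.
Variable R : realType.
Implicit Types (g : R * R) (v w : vec R).

Lemma secRic4_medial g : secRic R 4 g -> medial g.
Proof.
move=> sec; have [[x0 y0 z0'] _] := sec.
have z0 : 0 < 1 - g.1 - g.2 by lra.
(* Each test pairs a frame vector with the four frame vectors outside its own summand. Up to a
   positive factor the sum is a product of two of the slacks x + z - y, x + y - z, y + z - x. *)
have s1 := secRic_frame (i := o 0) (s := [tuple o 2; o 3; o 4; o 5]) sec isT.
have s2 := secRic_frame (i := o 2) (s := [tuple o 0; o 1; o 4; o 5]) sec isT.
have s3 := secRic_frame (i := o 4) (s := [tuple o 0; o 1; o 2; o 3]) sec isT.
move: s1 s2 s3.
rewrite /= !big_cons !big_nil !delta_row6 /sform !row6E /weight /tnth /=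
  /root_coef /nonroot_coef.
move: z0 x0 y0; rewrite /medial /=; set z := 1 - g.1 - g.2.
have : g.1 + g.2 + z = 1 by rewrite /z; ring.
move: (g.1) (g.2) z => x y z {sec z0'} E z0 x0 y0 s1 s2 s3.
have xyz0 : 0 < 4 * x * y * z by rewrite !mulr_gt0.
have [xn yn zn] : [/\ x != 0, y != 0 & z != 0] by rewrite !gt_eqF.
have h1 : 0 < (x + z - y) * (x + y - z).
  rewrite -(pmulr_rgt0 _ x0); have := mulr_gt0 xyz0 s1; congr (0 < _).
  by field; rewrite xn yn zn.
have h2 : 0 < (y + z - x) * (x + y - z).
  rewrite -(pmulr_rgt0 _ y0); have := mulr_gt0 xyz0 s2; congr (0 < _).
  by field; rewrite xn yn zn.
have h3 : 0 < (x + z - y) * (y + z - x).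
  rewrite -(pmulr_rgt0 _ z0); have := mulr_gt0 xyz0 s3; congr (0 < _).
  by field; rewrite xn yn zn.
move: h1 h2 h3; clear s1 s2 s3 xyz0 xn yn zn.
have -> : x + z - y = 1 - 2 * y by lra.
have -> : x + y - z = 2 * (x + y) - 1 by lra.
have -> : y + z - x = 1 - 2 * x by lra.
move=> h1 h2 h3.
(* The pairwise products being positive, the three slacks have one sign; their sum is 1, so they are
   positive. *)
have [x1|x1] := ltP x 2^-1.
  have a0 : 0 < 1 - 2 * x by lra.
  by move: h3 h2; rewrite (pmulr_lgt0 _ a0) (pmulr_rgt0 _ a0) => ? ?; split; lra.
have a0 : 1 - 2 * x <= 0 by lra.
by exfalso; nra.
Qed.

Lemma secRic4E : secRic R 4 = medial (R := R).
Proof. by apply/seteqP; split => g; [exact: secRic4_medial | exact: medial_secRic4]. Qed.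

Lemma ricci_gt0_secRic5 g (z := 1 - g.1 - g.2) : inv_metric g ->
  0 < 6 * g.2 * z + g.1 ^+ 2 - g.2 ^+ 2 - z ^+ 2 ->
  0 < 6 * g.1 * z + g.2 ^+ 2 - g.1 ^+ 2 - z ^+ 2 ->
  0 < 6 * g.1 * g.2 + z ^+ 2 - g.1 ^+ 2 - g.2 ^+ 2 -> secRic R 5 g.
Proof.
move=> gm r1 r2 r3; split=> // v w vw; rewrite (Ric5 gm vw).
have [x0 y0 z0'] := gm; have z0 : 0 < z by rewrite /z; lra.
case: vw; rewrite innerE -!expr2 -/z => vv _ _.
have sq (r s : R) : 0 <= r ^+ 2 + s ^+ 2 by rewrite addr_ge0 ?sqr_ge0.
have := @exists_pos_of_weighted_sum _ g.1 g.2 z _ _ _ (sq (v 0 (o 0)) (v 0 (o 1)))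
  (sq (v 0 (o 2)) (v 0 (o 3))) (sq (v 0 (o 4)) (v 0 (o 5))).
rewrite vv => /(_ ltr01) H; rewrite /ricform -/z.
set c1 := _ / _; set c2 := _ / (4 * g.1 * z); set c3 := _ / (4 * g.1 * g.2).
have [c10 c20 c30] : [/\ 0 < c1, 0 < c2 & 0 < c3].
  by split; apply: divr_gt0 => //; rewrite !mulr_gt0.
have := mulr_ge0 (ltW c10) (sq (v 0 (o 0)) (v 0 (o 1))).
have := mulr_ge0 (ltW c20) (sq (v 0 (o 2)) (v 0 (o 3))).
have := mulr_ge0 (ltW c30) (sq (v 0 (o 4)) (v 0 (o 5))).
case: H => H.
- have := mulr_gt0 c10 H; lra.
- have := mulr_gt0 c20 H; lra.
- have := mulr_gt0 c30 H; lra.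
Qed.

Lemma diagonal_secRic5 (x : R) : secRic R 5 (x, x) -> 8^-1 < x.
Proof.
move=> sec; have [[/= x0 _ z0'] _] := sec.
have z0 : 0 < 1 - x - x by lra.
have := secRic_frame (i := o 0) (s := [tuple o 1; o 2; o 3; o 4; o 5]) sec isT.
rewrite /= !big_cons !big_nil !delta_row6 /sform !row6E /weight /tnth /=
  /root_coef /nonroot_coef.
have [xn zn] : [/\ x != 0 & 1 - x - x != 0] by rewrite !gt_eqF.
rewrite (_ : _ + _ = (8 * x - 1) / (4 * x)); last by field; rewrite xn zn.
by rewrite pmulr_lgt0 ?invr_gt0 ?mulr_gt0 // => ?; lra.
Qed.

(** Testing a vector of m_12 against one or two vectors of m_13 gives x > 3/10; adding a vector of
    m_23 gives x > 5/18, the weakest of the bounds and hence common to the three values of d. *)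
Lemma diagonal_secRic3 d (x : R) : d \in [:: 1; 2; 3]%N -> secRic R d (x, x) -> 5 / 18 < x.
Proof.
rewrite !inE => /or3P[] /eqP-> sec; have [[/= x0 _ z0'] _] := sec.
all: have z0 : 0 < 1 - x - x by lra.
all: have [xn zn] : [/\ x != 0 & 1 - x - x != 0] by rewrite !gt_eqF.
- have := secRic_frame (i := o 0) (s := [tuple o 2]) sec isT.
  rewrite /= !big_cons !big_nil !delta_row6 /sform !row6E /weight /tnth /=
  /root_coef /nonroot_coef.
  rewrite (_ : _ + _ = (10 * x - 3) / (16 * x)); last by field; rewrite xn zn.
  by rewrite pmulr_lgt0 ?invr_gt0 ?mulr_gt0 // => ?; lra.
- have := secRic_frame (i := o 0) (s := [tuple o 2; o 3]) sec isT.
  rewrite /= !big_cons !big_nil !delta_row6 /sform !row6E /weight /tnth /=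
  /root_coef /nonroot_coef.
  rewrite (_ : _ + _ = (10 * x - 3) / (8 * x)); last by field; rewrite xn zn.
  by rewrite pmulr_lgt0 ?invr_gt0 ?mulr_gt0 // => ?; lra.
- have := secRic_frame (i := o 0) (s := [tuple o 2; o 3; o 4]) sec isT.
  rewrite /= !big_cons !big_nil !delta_row6 /sform !row6E /weight /tnth /=
  /root_coef /nonroot_coef.
  rewrite (_ : _ + _ = (18 * x - 5) / (16 * x)); last by field; rewrite xn zn.
  by rewrite pmulr_lgt0 ?invr_gt0 ?mulr_gt0 // => ?; lra.
Qed.

(** In the variables w1 + w2, w1 - w2, w3 the form splits into a positive multiple of (w1 + w2)^2
    and a binary form, whose discriminant condition is the last hypothesis. *)
Lemma qform3_ge0 (p c o3 o1 w1 w2 w3 : R) :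
  0 < o3 -> o3 < p -> 2 * o1 ^+ 2 <= (p - o3) * c ->
  0 <= p * (w1 ^+ 2 + w2 ^+ 2) + c * w3 ^+ 2
    + 2 * o3 * (w1 * w2) - 2 * o1 * (w1 * w3) + 2 * o1 * (w2 * w3).
Proof.
move=> o30 o3p H; have po : 0 < 2 * (p - o3) by lra.
rewrite -(pmulr_rge0 _ po).
rewrite [leRHS](_ : _ = (p - o3) * (p + o3) * (w1 + w2) ^+ 2
  + ((p - o3) * (w1 - w2) - 2 * o1 * w3) ^+ 2
  + 2 * ((p - o3) * c - 2 * o1 ^+ 2) * w3 ^+ 2); last by ring.
apply: (addr_ge0 (addr_ge0 _ (sqr_ge0 _))); apply: mulr_ge0; rewrite ?sqr_ge0 //; last by lra.
by apply: mulr_ge0; lra.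
Qed.

(* [e] bounds the curvature from below.  The coefficients [o3], [o1] of the cross
   terms are chosen so that the form [F] in the [om_i] remains nonnegative while
   [l3], [l1] and [e * x] stay positive. *)
Lemma diagonal_secRic d (x : R) : (0 < d)%N -> 31 / 100 < x < 63 / 200 ->
  secRic R d (x, x).
Proof.
move=> d0 /andP[xl xu].
have gm : inv_metric (x, x) by split => /=; lra.
split=> // v w vw; rewrite (Ric_sform gm vw); case: vw => vv vwi ww.
pose e : R := 1 / (64 * 64).
have e0 : 0 < e by rewrite divr_gt0 // mulr_gt0.
(* A positive lower bound on each single sectional curvature serves every d > 0 at once. *)
suff H (u : vec R) : inner (x, x) u u = 1 -> inner (x, x) v u = 0 ->
    e <= sform x x (1 - x - x) v u.
  case: d d0 w vwi ww => // d _ w vwi ww.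
  rewrite big_ord_recl ltr_pwDl ?sumr_ge0 //= => [|i _].
    by apply: lt_le_trans (H _ _ (vwi _)); rewrite ?ww ?eqxx.
  by apply: le_trans (H _ _ (vwi _)); rewrite ?(ltW e0) // ww eqxx.
move=> uu vu.
(* [L] is the squared area of (v, u). Writing [e] as [e * L] turns the bound into an inequality
   between forms of the same degree in v and u. *)
pose L := inner (x, x) v v * inner (x, x) u u - inner (x, x) v u ^+ 2.
have -> : e = e * L by rewrite /L uu vv vu; ring.
rewrite -subr_ge0 /L !innerE /sform /=.
move: (v 0 (o 0)) (v 0 (o 1)) (v 0 (o 2))
  (v 0 (o 3)) (v 0 (o 4)) (v 0 (o 5)) => p0 p1 p2 p3 p4 p5.
move: (u 0 (o 0)) (u 0 (o 1)) (u 0 (o 2))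
  (u 0 (o 3)) (u 0 (o 4)) (u 0 (o 5)) => q0 q1 q2 q3 q4 q5.
pose z := 1 - x - x.
have x0 : 0 < x by lra.
have xn : x != 0 by rewrite gt_eqF.
have z0 : 0 < z by rewrite /z; lra.
have zn : z != 0 by rewrite gt_eqF.
pose o3 := x / 2 + 2 * e * x + e * x ^+ 2.
pose o1 := (3 * x * z - z ^+ 2) / (4 * x) + 2 * e * x + e * x * z.
pose l3 := (4 * x - 3 * z) / 16 - e * x ^+ 2 - e * x.
pose l1 := z ^+ 2 / (16 * x) - e * x * z - e * x.
(* By the Pluecker relations the squared norms of the two weight components of m_i /\ m_j differ by
   4 om_i om_j, up to sign. Adding cross terms to [F] thus raises the negative coefficients
   [nonroot_coef] to [e * x] in [G], and lowers [root_coef] to [l3] and [l1]. *)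
pose F : R :=
  (x - e * x ^+ 2) * ((p0 * q1 - p1 * q0) ^+ 2 + (p2 * q3 - p3 * q2) ^+ 2)
  + (z - e * z ^+ 2) * (p4 * q5 - p5 * q4) ^+ 2
    + 2 * o3 * ((p0 * q1 - p1 * q0) * (p2 * q3 - p3 * q2))
    - 2 * o1 * ((p0 * q1 - p1 * q0) * (p4 * q5 - p5 * q4))
    + 2 * o1 * ((p2 * q3 - p3 * q2) * (p4 * q5 - p5 * q4)).
pose G : R := l3 * ((p0 * q2 + p1 * q3 - p2 * q0 - p3 * q1) ^+ 2
                 + (p0 * q3 - p1 * q2 + p2 * q1 - p3 * q0) ^+ 2)
  + e * x * ((p0 * q2 - p1 * q3 - p2 * q0 + p3 * q1) ^+ 2
                 + (p0 * q3 + p1 * q2 - p2 * q1 - p3 * q0) ^+ 2)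
  + l1 * ((p4 * q0 - p5 * q1 - p0 * q4 + p1 * q5) ^+ 2
                 + (p4 * q1 + p5 * q0 - p0 * q5 - p1 * q4) ^+ 2)
  + e * x * ((p0 * q4 + p1 * q5 - p4 * q0 - p5 * q1) ^+ 2
                 + (p0 * q5 - p1 * q4 + p4 * q1 - p5 * q0) ^+ 2)
  + l1 * ((p2 * q4 + p3 * q5 - p4 * q2 - p5 * q3) ^+ 2
                 + (p3 * q4 - p2 * q5 - p4 * q3 + p5 * q2) ^+ 2)
  + e * x * ((p2 * q4 - p3 * q5 - p4 * q2 + p5 * q3) ^+ 2
                 + (p3 * q4 + p2 * q5 - p4 * q3 - p5 * q2) ^+ 2).
rewrite [leRHS](_ : _ = F + G); last first.
  by rewrite /F /G /o3 /o1 /l3 /l1 /root_coef /nonroot_coef -/z; field; rewrite xn zn.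
have z0' : 37 / 100 < z < 38 / 100 by rewrite /z; lra.
have [zl zu] : 37 / 100 < z /\ z < 38 / 100 by split; rewrite /z; lra.
have eE : e = 1 / 64 / 64 by rewrite /e; field.
clearbody e.
apply: addr_ge0.
  apply: qform3_ge0; rewrite /o3.
  - by rewrite !addr_gt0 ?mulr_gt0 ?exprn_gt0.
  - by rewrite eE; nra.
  have o1u : o1 <= 17 / 100.
    have : (3 * x * z - z ^+ 2) / (4 * x) <= 849 / 50 / 100.
      by rewrite ler_pdivrMr ?mulr_gt0 // /z; nra.
    have : e * x * z <= 3 / 100 / 1000 by rewrite eE; nra.
    by rewrite /o1 eE; nra.
  have o10 : 0 <= o1.
    by rewrite /o1 !addr_ge0 ?mulr_ge0 ?invr_ge0 ?ltW // ?mulr_gt0 // subr_gt0 /z; nra.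
  (* The margin is narrow: twice this square is 578/10000, against the lower bound 581/10000 for the
     other side. *)
  have : o1 ^+ 2 <= (17 / 100) ^+ 2 by rewrite ler_sqr ?nnegrE //; lra.
  have : 581 / 100 / 100 <= (x / 2 - 1 / 40 / 100) * (z - 1 / 200 / 100).
    by rewrite /z; nra.
  have : (x / 2 - 1 / 40 / 100) * (z - 1 / 200 / 100) <=
      (x - e * x ^+ 2 - (x / 2 + 2 * e * x + e * x ^+ 2)) * (z - e * z ^+ 2).
    apply: ler_pM; rewrite ?eE; nra.
  lra.
have sq (r s : R) : 0 <= r ^+ 2 + s ^+ 2 by rewrite addr_ge0 ?sqr_ge0.
have l30 : 0 <= l3 by rewrite /l3 eE; move: zl zu; rewrite /z => zl zu; nra.
have l10 : 0 <= l1.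
  have : 15 / 1000 <= z ^+ 2 / (16 * x) by rewrite ler_pdivlMr ?mulr_gt0 //; nra.
  by rewrite /l1 eE; nra.
rewrite /G !addr_ge0 // !mulr_ge0 //; exact: ltW.
Qed.

End Regions.

(** * Ordinary differential equations *)

Section Calculus.
Variable R : realType.
Implicit Types (f g : R -> R) (t : R).

(** This rule and the following ones are stated for explicit abstractions, so that derivatives of
    compound expressions can be assembled as proof terms. *)
Lemma is_derive1D f g t (a b : R) : is_derive t 1 f a -> is_derive t 1 g b ->
  is_derive t 1 (fun s => f s + g s) (a + b).
Proof. by move=> ? ?; exact: is_deriveD. Qed.

Lemma is_derive1B f g t (a b : R) : is_derive t 1 f a -> is_derive t 1 g b ->
  is_derive t 1 (fun s => f s - g s) (a - b).
Proof. by move=> ? ?; exact: is_deriveB. Qed.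

Lemma is_derive1M f g t (a b : R) : is_derive t 1 f a -> is_derive t 1 g b ->
  is_derive t 1 (fun s => f s * g s) (f t * b + g t * a).
Proof. by move=> ? ?; exact: is_deriveM. Qed.

Lemma is_derive1_cst t (c : R) : is_derive t 1 (fun _ : R => c) 0.
Proof. exact: is_derive_cst. Qed.

Lemma is_derive1N f t (a : R) : is_derive t 1 f a -> is_derive t 1 (fun s => - f s) (- a).
Proof. by move=> ?; exact: is_deriveN. Qed.

Lemma is_derive1Z f t (c a : R) : is_derive t 1 f a -> is_derive t 1 (fun s => c * f s) (c * a).
Proof. by move=> ?; exact: is_deriveZ. Qed.

Lemma is_derive1_expR f t (a : R) : is_derive t 1 f a ->
  is_derive t 1 (fun s => expR (f s)) (expR (f t) * a).
Proof. by move=> fa; apply: is_derive1_comp. Qed.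

Lemma is_derive1_reflect f t (a : R) : is_derive (- t) 1 f a ->
  is_derive t 1 (fun s => f (- s)) (- a).
Proof.
move=> fa; rewrite -mulrN1.
apply: (is_derive1_comp (f := f) (g := fun s => - s)).
Qed.

Lemma is_derive1_continuous f t (a : R) : is_derive t 1 f a -> {for t, continuous f}.
Proof. by move=> [fa _]; apply/differentiable_continuous/derivable1_diffP. Qed.

Lemma is_derive1_MVT f (df : R -> R) a b : a <= b ->
  (forall t, a <= t <= b -> is_derive t 1 f (df t)) ->
  exists2 c, a <= c <= b & f b - f a = df c * (b - a).
Proof.
move=> ab H; have [||c cab E] := @MVT_segment _ f df a b ab.
- by move=> t /itvP tab; apply: H; rewrite !tab.
- apply: derivable_within_continuous => t; rewrite in_itv /= => tab.
  by case: (H t tab).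
- by exists c.
Qed.

Lemma is_derive1_le f (df : R -> R) a b : a <= b ->
  (forall t, a <= t <= b -> is_derive t 1 f (df t)) ->
  (forall t, a <= t <= b -> 0 <= df t) -> f a <= f b.
Proof.
move=> ab H H0; have [c cab E] := is_derive1_MVT ab H.
by rewrite -subr_ge0 E mulr_ge0 ?H0 // subr_ge0.
Qed.

Lemma is_derive1_0_cst f a b :
  (forall t, Num.min a b <= t <= Num.max a b -> is_derive t 1 f 0) -> f a = f b.
Proof.
wlog ab : a b / a <= b => [hw|].
  by case/orP: (le_total a b) => [/hw //|ba] H; apply/esym/hw => //; rewrite minC maxC.
rewrite (min_idPl ab) (max_idPr ab) => H.
have [c _ /eqP] := is_derive1_MVT (df := fun=> 0) ab H.
by rewrite mul0r subr_eq0 => /eqP ->.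
Qed.

(** Both g + f and g - f are nondecreasing and vanish at 0, so they have the sign of t. *)
Lemma is_derive1_cmp f (df : R -> R) g (dg : R -> R) : f 0 = 0 -> g 0 = 0 ->
  (forall t, is_derive t 1 f (df t)) -> (forall t, is_derive t 1 g (dg t)) ->
  (forall t, `|df t| <= dg t) -> forall t, `|f t| <= `|g t|.
Proof.
move=> f0 g0 Hf Hg H t.
have H1 s : 0 <= dg s + df s by have := H s; rewrite ler_norml => /andP[]; lra.
have H2 s : 0 <= dg s - df s by have := H s; rewrite ler_norml => /andP[]; lra.
have P a b (ab : a <= b) := is_derive1_le ab (fun s _ => is_derive1D (Hg s) (Hf s))
  (fun s _ => H1 s).
have M a b (ab : a <= b) := is_derive1_le ab (fun s _ => is_derive1B (Hg s) (Hf s))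
  (fun s _ => H2 s).
have [t0|/ltW t0] := leP 0 t.
  have := P _ _ t0; have := M _ _ t0; rewrite f0 g0 => ? ?.
  by rewrite (@ger0_norm _ (g t)) ?ler_norml; [apply/andP; split|]; lra.
have := P _ _ t0; have := M _ _ t0; rewrite f0 g0 => ? ?.
by rewrite (@ler0_norm _ (g t)) ?ler_norml; [apply/andP; split|]; lra.
Qed.

Lemma exists_primitive f : continuous f ->
  exists F : R -> R, (forall t, is_derive t 1 F (f t)) /\ F 0 = 0.
Proof.
move=> cf.
pose P (N x : R) : R := (\int[lebesgue_measure]_(t in [set` `[- N, x]]) (f t))%R.
have derP (N x : R) : - N < x -> is_derive x 1 (P N) (f x).
  move=> Nx.
  have intf : lebesgue_measure.-integrable `[- N, x + 1] (EFin \o f).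
    apply: continuous_compact_integrable; first exact: segment_compact.
    exact: continuous_subspaceT.
  have x1 : x < x + 1 by rewrite ltrDl.
  have aux (F : R -> R) : derivable F x 1 /\ derive1 F x = f x -> is_derive x 1 F (f x).
    by case=> d e; apply: DeriveDef => //; rewrite -e derive1E.
  exact: aux (continuous_FTC1_closed x1 intf Nx (cf x)).
(* [P N] has derivative [f] beyond [- N] only, hence the varying base point. *)
pose F (x : R) := P (`|x| + 1) x - P (`|x| + 1) 0.
exists F; split; last by rewrite /F subrr.
move=> t; pose M := `|t| + 2.
apply: (@near_eq_is_derive _ _ _ (fun x => P M x - P M 0)); last first.
  have Mt : - M < t by rewrite /M; have := ler_norm (- t); rewrite normrN; lra.
  by rewrite -[f t]subr0; exact: is_derive1B (derP _ _ Mt) (is_derive1_cst t (P M 0)).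
near=> x.
have : ball t 1 x by near: x; exact: nbhsx_ballx.
rewrite /ball /= distrC => xt.
have xM : `|x| < `|t| + 1.
  by have := ler_normD (x - t) t; rewrite subrK; lra.
rewrite /F; set N := `|x| + 1.
(* To the right of both base points [P M] and [P N] have the same derivative, so their increments
   from 0 to [x] agree. *)
have := @is_derive1_0_cst (fun s => P M s - P N s) 0 x; rewrite -/M => H.
suff E : P M 0 - P N 0 = P M x - P N x.
  by move: (P M 0) (P N 0) (P M x) (P N x) E; clear => *; lra.
apply: H => s /andP[s1 _]; rewrite -(subrr (f s)); apply: is_derive1B; apply: derP.
  apply: lt_le_trans s1; rewrite lt_min /M; have := normr_ge0 t; have := ler_norm (- x).
  by rewrite normrN => ? ?; apply/andP; split; lra.
apply: lt_le_trans s1; rewrite lt_min /N; have := normr_ge0 x; have := ler_norm (- x).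
by rewrite normrN => ? ?; apply/andP; split; lra.
Unshelve. all: by end_near. Qed.

(** With K a primitive of k, D exp(-K) is nonincreasing on t >= 0 and D exp(K) is nondecreasing on t
    <= 0; both are at most their value 0 at the origin. *)
Lemma gronwall0 (D dD k : R -> R) : continuous k -> (forall t, is_derive t 1 D (dD t)) ->
  (forall t, 0 <= D t) -> (forall t, `|dD t| <= k t * D t) -> D 0 = 0 -> forall t, D t = 0.
Proof.
move=> ck HD D0 H D00 t.
have [K [HK K0]] := exists_primitive ck.
have [t0|/ltW t0] := leP 0 t.
  have h (s : R) : is_derive s 1 (fun u => - (D u * expR (- K u)))
      (- (D s * (expR (- K s) * - k s) + expR (- K s) * dD s)).
    by apply: is_derive1N; apply: is_derive1M => //; apply: is_derive1_expR; exact: is_derive1N.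
  have := is_derive1_le t0 (fun s _ => h s).
  rewrite D00 mul0r oppr0 => H0; apply/eqP; rewrite eq_le D0 andbT.
  rewrite -(pmulr_lle0 _ (expR_gt0 (- K t))) -oppr_ge0; apply: H0 => s _.
  rewrite (_ : - _ = expR (- K s) * (k s * D s - dD s)); last by ring.
  by rewrite mulr_ge0 ?expR_ge0 // subr_ge0; exact: le_trans (ler_norm _) (H s).
have h (s : R) : is_derive s 1 (fun u => D u * expR (K u))
    (D s * (expR (K s) * k s) + expR (K s) * dD s).
  by apply: is_derive1M => //; exact: is_derive1_expR.
have := is_derive1_le t0 (fun s _ => h s).
rewrite D00 mul0r => H0; apply/eqP; rewrite eq_le D0 andbT.
rewrite -(pmulr_lle0 _ (expR_gt0 (K t))); apply: H0 => s _.
rewrite (_ : _ + _ = expR (K s) * (k s * D s + dD s)); last by ring.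
rewrite mulr_ge0 ?expR_ge0 //; have := H s; rewrite ler_norml => /andP[]; lra.
Qed.

Lemma linear_ode_exp f (k : R -> R) : continuous k ->
  (forall t, is_derive t 1 f (f t * k t)) ->
  exists K : R -> R, [/\ (forall t, is_derive t 1 K (k t)), K 0 = 0 &
    forall t, f t = f 0 * expR (K t)].
Proof.
move=> ck Hf; have [K [HK K0]] := exists_primitive ck; exists K; split => // t.
have h (s : R) : is_derive s 1 (fun u => f u * expR (- K u)) 0.
  rewrite -[0](_ : f s * (expR (- K s) * - k s) + expR (- K s) * (f s * k s) = _); last by ring.
  by apply: is_derive1M => //; apply: is_derive1_expR; exact: is_derive1N.
have := @is_derive1_0_cst _ t 0 (fun s _ => h s).
rewrite K0 oppr0 expR0 mulr1 => <-.
by rewrite -mulrA -expRD addNr expR0 mulr1.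
Qed.

(** If f t < 0 with t > 0, let s0 be the last point of [0, t] where f is nonnegative. Beyond it f' =
    0, so f t = f s0 by the mean value theorem, a contradiction. Time reversal covers t < 0. *)
Lemma is_derive1_ge0_invariant f (df : R -> R) : (forall t, is_derive t 1 f (df t)) ->
  0 <= f 0 -> (forall t, f t < 0 -> df t = 0) -> forall t, 0 <= f t.
Proof.
move=> Hf f0 H t.
wlog t0 : f df Hf f0 H t / 0 <= t => [hw|].
  have [/(hw f df)|/ltW t0] := leP 0 t; first exact.
  rewrite -(opprK t); apply: (hw (fun s => f (- s)) (fun s => - df (- s)));
    rewrite ?oppr0 ?oppr_ge0 //.
    by move=> s; exact: is_derive1_reflect.
  by move=> s /H ->; rewrite oppr0.
rewrite leNgt; apply/negP => ft.
have cf : continuous f by move=> s; exact: is_derive1_continuous (Hf s).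
pose S := `[0, t] `&` f @^-1` [set y | 0 <= y].
have S0 : S !=set0 by exists 0; split => //=; rewrite in_itv /= lexx.
have cS : compact S.
  apply: compact_closedI; first exact: segment_compact.
  by apply: preimage_closed; [by move=> x _; exact: cf | exact: closed_ge].
have [s0 + s0max] := @compact_EVT_max _ R id S S0 cS (continuous_subspaceT (fun x => cvg_id)).
rewrite inE => -[]; rewrite /= in_itv /= => /andP[s00 s0t] fs0.
have {}s0t : s0 < t.
  by rewrite lt_neqAle s0t andbT; apply: contraTneq ft => <-; rewrite -leNgt.
have [c /itvP cs] := MVT s0t (fun x _ => Hf x) (continuous_subspaceT cf).
rewrite H ?mul0r; last first.
  rewrite ltNge; apply/negP => fc.
  have : c \in S by rewrite inE; split => //=; rewrite in_itv /= (le_trans s00) ?cs.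
  by move=> /s0max; rewrite /= leNgt cs.
by lra.
Qed.

End Calculus.

(** * Global solutions of bounded Lipschitz planar systems by Picard iteration *)

Section Picard.
Variable R : realType.
Implicit Types (f g : R -> R) (t : R).

Lemma le_of_geometric (a b A : R) : (forall n, a <= b + A / 2 ^+ n) -> a <= b.
Proof.
move=> H; rewrite leNgt; apply/negP => ba.
have d0 : 0 < a - b by rewrite subr_gt0.
have A0 : 0 < A by have := H 0%N; rewrite expr0 divr1; lra.
have := archi_boundP (ltW (divr_gt0 A0 d0)); set n := Num.bound _ => An.
have : A / 2 ^+ n < a - b.
  rewrite ltr_pdivrMr ?exprn_gt0 // mulrC -ltr_pdivrMr //.
  apply: lt_trans An _; rewrite -natrX ltr_nat; exact: ltn_expl.
by have := H n; lra.
Qed.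

(** The bounds u n - 2 A / 2^n increase and the bounds u n + 2 A / 2^n decrease; the supremum of the
    former is the limit, with an explicit error. *)
Lemma geometric_limit (u : nat -> R) (A : R) :
  (forall n, `|u n.+1 - u n| <= A / 2 ^+ n) ->
  exists l, forall n, `|u n - l| <= 2 * A / 2 ^+ n.
Proof.
move=> H.
have step n : 2 * A / 2 ^+ n = A / 2 ^+ n + 2 * A / 2 ^+ n.+1.
  by rewrite exprS; field; rewrite expf_neq0.
have A0 n : 0 <= A / 2 ^+ n by exact: le_trans (H n).
have lower m n : u m - 2 * A / 2 ^+ m <= u (m + n)%N - 2 * A / 2 ^+ (m + n).
  elim: n => [|n IH]; first by rewrite addn0.
  apply: le_trans IH _; rewrite addnS (step (m + n)%N).
  by have := H (m + n)%N; rewrite ler_norml => /andP[]; lra.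
have upper m n : u (m + n)%N + 2 * A / 2 ^+ (m + n) <= u m + 2 * A / 2 ^+ m.
  elim: n => [|n IH]; first by rewrite addn0.
  apply: le_trans IH; rewrite addnS (step (m + n)%N).
  by have := H (m + n)%N; rewrite ler_norml => /andP[]; lra.
have cross m n : u m - 2 * A / 2 ^+ m <= u n + 2 * A / 2 ^+ n.
  apply: le_trans (lower m n) _; apply: le_trans (upper n m).
  by rewrite addnC; have := A0 (n + m)%N; lra.
pose S := range (fun m => u m - 2 * A / 2 ^+ m).
have S0 : S !=set0 by exists (u 0%N - 2 * A / 2 ^+ 0), 0%N.
have Sb n : ubound S (u n + 2 * A / 2 ^+ n) by move=> _ [m _ <-].
exists (sup S) => n; rewrite ler_norml; apply/andP; split.
  by have := ge_sup S0 (Sb n); lra.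
have : u n - 2 * A / 2 ^+ n <= sup S.
  by apply: ub_le_sup; [exists (u 0%N + 2 * A / 2 ^+ 0) | exists n].
lra.
Qed.

(** Choice with the zero function as default makes this total, so the Picard iterates can be defined
    before they are known to be continuous. *)
Definition primitive f : R -> R :=
  xget (fun=> 0) [set F | (forall t, is_derive t 1 F (f t)) /\ F 0 = 0].

Lemma primitiveP f : continuous f ->
  (forall t, is_derive t 1 (primitive f) (f t)) /\ primitive f 0 = 0.
Proof. by move=> /exists_primitive; exact: xgetPex. Qed.

Variables (U V : R -> R -> R) (M L x0 y0 : R).
Hypothesis L1 : 1 <= L.
Hypothesis UM : forall a b, `|U a b| <= M.
Hypothesis VM : forall a b, `|V a b| <= M.
Hypothesis UL : forall a b a' b', `|U a b - U a' b'| <= L * (`|a - a'| + `|b - b'|).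
Hypothesis VL : forall a b a' b', `|V a b - V a' b'| <= L * (`|a - a'| + `|b - b'|).

Let L0 : 0 < L. Proof. exact: lt_le_trans L1. Qed.

Lemma continuous_lip2 (W : R -> R -> R) f g :
  (forall a b a' b', `|W a b - W a' b'| <= L * (`|a - a'| + `|b - b'|)) ->
  continuous f -> continuous g -> continuous (fun t => W (f t) (g t)).
Proof.
move=> WL cf cg t; apply/cvgrPdist_lt => e e0.
have e' : 0 < e / (2 * L) by rewrite divr_gt0 // mulr_gt0.
near=> s.
have hf : `|f t - f s| < e / (2 * L).
  by near: s; move: (e / _) e'; apply/cvgrPdist_lt; exact: cf.
have hg : `|g t - g s| < e / (2 * L).
  by near: s; move: (e / _) e'; apply/cvgrPdist_lt; exact: cg.
apply: le_lt_trans (WL _ _ _ _) _.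
have -> : e = L * (e / (2 * L) + e / (2 * L)) by field; rewrite gt_eqF.
by rewrite ltr_pM2l // ltrD.
Unshelve. all: by end_near. Qed.

Fixpoint picard n : (R -> R) * (R -> R) :=
  if n isn't n'.+1 then (fun=> x0, fun=> y0) else
  let P := picard n' in
  (fun t => x0 + primitive (fun s => U (P.1 s) (P.2 s)) t,
   fun t => y0 + primitive (fun s => V (P.1 s) (P.2 s)) t).

Lemma picard_continuous n : continuous (picard n).1 /\ continuous (picard n).2.
Proof.
elim: n => [|n [IH1 IH2]] /=; first by split=> t; exact: cvg_cst.
have [H1 _] := primitiveP (continuous_lip2 UL IH1 IH2).
have [H2 _] := primitiveP (continuous_lip2 VL IH1 IH2).
split=> t.
  by have h := is_derive1D (is_derive1_cst t x0) (H1 t); apply: is_derive1_continuous h.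
by have h := is_derive1D (is_derive1_cst t y0) (H2 t); apply: is_derive1_continuous h.
Qed.

Lemma picard_derive n t :
  is_derive t 1 (picard n.+1).1 (U ((picard n).1 t) ((picard n).2 t)) /\
  is_derive t 1 (picard n.+1).2 (V ((picard n).1 t) ((picard n).2 t)).
Proof.
have [c1 c2] := picard_continuous n.
have [H1 _] := primitiveP (continuous_lip2 UL c1 c2).
have [H2 _] := primitiveP (continuous_lip2 VL c1 c2).
split; rewrite -[X in is_derive _ _ _ X]add0r.
  exact: is_derive1D (is_derive1_cst t x0) (H1 t).
exact: is_derive1D (is_derive1_cst t y0) (H2 t).
Qed.

Lemma picard0 n : (picard n).1 0 = x0 /\ (picard n).2 0 = y0.
Proof.
case: n => [//|n] /=; have [c1 c2] := picard_continuous n.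
have [_ ->] := primitiveP (continuous_lip2 UL c1 c2).
have [_ ->] := primitiveP (continuous_lip2 VL c1 c2).
by rewrite !addr0.
Qed.

Let K := 4 * L.
Let ch t := expR (K * t) + expR (- (K * t)).
Let sh t := expR (K * t) - expR (- (K * t)).

Let K0 : 0 < K. Proof. by rewrite mulr_gt0. Qed.

Let ch_ge1 t : 1 <= ch t.
Proof.
have [t0|t0] := leP 0 (K * t).
  by have := expR_ge1Dx (K * t); have := expR_ge0 (- (K * t)); rewrite /ch; lra.
by have := expR_ge1Dx (- (K * t)); have := expR_ge0 (K * t); rewrite /ch; lra.
Qed.

Let sh_le_ch t : `|sh t| <= ch t.
Proof.
have := expR_ge0 (- (K * t)); have := expR_ge0 (K * t).
by rewrite /ch /sh ler_norml => ? ?; apply/andP; split; lra.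
Qed.

(* The weight [ch] grows at rate [K = 4 L], which makes integration of an
   [L]-Lipschitz field a contraction on all of [R] at once. *)
Let weighted_integration f (df : R -> R) (A : R) : 0 <= A -> f 0 = 0 ->
  (forall t, is_derive t 1 f (df t)) -> (forall t, `|df t| <= L * (A * ch t)) ->
  forall t, `|f t| <= A / 4 * ch t.
Proof.
move=> A0 f0 Hf H t.
have Hg (s : R) : is_derive s 1 (fun r : R => A / 4 * sh r) (L * (A * ch s)).
  have -> : L * (A * ch s) = A / 4 * (expR (K * s) * K - expR (- (K * s)) * - K).
    by rewrite /ch /K; field.
  have dK : is_derive s 1 (fun r : R => K * r) K.
    by rewrite -[X in is_derive _ _ _ X]mulr1; exact: (is_derive1Z (f := id)).
  exact: is_derive1Z (is_derive1B (is_derive1_expR dK) (is_derive1_expR (is_derive1N dK))).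
have := is_derive1_cmp f0 _ Hf Hg H t; rewrite /sh mulr0 oppr0 subrr mulr0 => /(_ erefl).
move/le_trans; apply; rewrite normrM (@ger0_norm _ (A / 4)) ?divr_ge0 //.
by rewrite ler_wpM2l ?divr_ge0 ?sh_le_ch.
Qed.

(** [weighted_integration] gains a factor 4, and the Lipschitz bound adds two coordinates of equal
    size: the increments are halved at each step. *)
Lemma picard_step n t :
  `|(picard n.+1).1 t - (picard n).1 t| <= M * ch t / 2 ^+ n /\
  `|(picard n.+1).2 t - (picard n).2 t| <= M * ch t / 2 ^+ n.
Proof.
have M0 : 0 <= M by apply: le_trans (UM 0 0).
elim: n t => [|n IH] t.
  have [H1 H2] : (forall s : R, is_derive s 1 (picard 1).1 (U x0 y0)) /\
      (forall s : R, is_derive s 1 (picard 1).2 (V x0 y0)).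
    by split=> s; have [] := picard_derive 0 s.
  have W (c d : R) (h : R -> R) : `|d| <= M -> h 0 = c ->
      (forall s : R, is_derive s 1 h d) ->
      `|h t - c| <= M * ch t / 2 ^+ 0.
    move=> dM h0 Hh; rewrite expr0 divr1.
    have := @weighted_integration (fun s => h s - c) (fun=> d) M M0.
    rewrite h0 subrr => /(_ erefl) H; apply: le_trans (H _ _ t) _.
    - by move=> s; rewrite -[d]subr0; apply: is_derive1B => //; exact: is_derive1_cst.
    (* Here 1 <= L and 1 <= ch s turn the bound M into L * (M * ch s). *)
    - move=> s; apply: le_trans dM _; rewrite -[leLHS]mul1r.
      apply: ler_pM => //; rewrite -[leLHS]mulr1; exact: ler_wpM2l.
    - by rewrite ler_wpM2r //; [exact: le_trans (ch_ge1 t) | lra].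
  have [p1 p2] := picard0 1.
  by split; [apply: W p1 H1 | apply: W p2 H2].
have W (W : R -> R -> R) (h h' : R -> R) :
    (forall a b a' b', `|W a b - W a' b'| <= L * (`|a - a'| + `|b - b'|)) ->
    h 0 = h' 0 ->
    (forall s : R, is_derive s 1 h (W ((picard n.+1).1 s) ((picard n.+1).2 s))) ->
    (forall s : R, is_derive s 1 h' (W ((picard n).1 s) ((picard n).2 s))) ->
    `|h t - h' t| <= M * ch t / 2 ^+ n.+1.
  move=> WL h0 Hh Hh'.
  have n0 : 0 <= (2 ^+ n)^-1 :> R by rewrite invr_ge0 exprn_ge0.
  have := @weighted_integration (fun s => h s - h' s) _ (2 * M / 2 ^+ n) _ _
    (fun s => is_derive1B (Hh s) (Hh' s)).
  rewrite h0 subrr => H; apply: le_trans (H _ erefl _ t) _.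
  - by rewrite !mulr_ge0.
  - move=> s; apply: le_trans (WL _ _ _ _) _; apply: ler_wpM2l; first exact: ltW.
    by have [] := IH s; set c := M * ch s / _ => ? ?; rewrite (_ : 2 * M / _ * _ = c + c);
      [lra | rewrite /c; ring].
  - rewrite exprS invfM; set c := (2 ^+ n)^-1; lra.
have [[p1 p2] [q1 q2]] := (picard0 n.+2, picard0 n.+1).
by split; [apply: (W U) => // [|s|s] | apply: (W V) => // [|s|s]];
  rewrite ?p1 ?q1 ?p2 ?q2 //; [have [] := picard_derive n.+1 s | have [] := picard_derive n s
   | have [] := picard_derive n.+1 s | have [] := picard_derive n s].
Qed.

(** A Lipschitz constant common to all iterates passes to the pointwise limit and makes it
    continuous. *)
Let picard_lipschitz n s t :
  `|(picard n).1 t - (picard n).1 s| <= M * `|t - s| /\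
  `|(picard n).2 t - (picard n).2 s| <= M * `|t - s|.
Proof.
have M0 : 0 <= M by apply: le_trans (UM 0 0).
case: n => [|n]; first by rewrite /= !subrr normr0 mulr_ge0.
have W (h d : R -> R) : (forall r, is_derive r (1 : R) h (d r)) -> (forall r, `|d r| <= M) ->
    `|h t - h s| <= M * `|t - s|.
  move=> Hh dM; wlog st : s t / s <= t => [hw|].
    by case/orP: (le_total s t) => /hw //; rewrite distrC (distrC s).
  have [c _ ->] := is_derive1_MVT st (fun r _ => Hh r).
  by rewrite normrM ler_wpM2r.
split.
  by apply: W (fun r => (picard_derive n r).1) _.
by apply: W (fun r => (picard_derive n r).2) _.
Qed.

Theorem picard_lindelof : exists X Y : R -> R, [/\ X 0 = x0, Y 0 = y0,
  (forall t, is_derive t 1 X (U (X t) (Y t))) &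
  (forall t, is_derive t 1 Y (V (X t) (Y t)))].
Proof.
have M0 : 0 <= M by apply: le_trans (UM 0 0).
have ch0 t : 0 <= ch t by exact: le_trans (ch_ge1 t).
have /choice [X HX] : forall t, exists l, forall n,
    `|(picard n).1 t - l| <= 2 * (M * ch t) / 2 ^+ n.
  by move=> t; apply: geometric_limit => n; have [] := picard_step n t.
have /choice [Y HY] : forall t, exists l, forall n,
    `|(picard n).2 t - l| <= 2 * (M * ch t) / 2 ^+ n.
  by move=> t; apply: geometric_limit => n; have [] := picard_step n t.
have lip (Z : R -> R) (p : nat -> R -> R) :
    (forall t n, `|p n t - Z t| <= 2 * (M * ch t) / 2 ^+ n) ->
    (forall n s t, `|p n t - p n s| <= M * `|t - s|) -> continuous Z.
  move=> HZ Hp.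
  have ZL s t : `|Z t - Z s| <= M * `|t - s|.
    apply: (@le_of_geometric _ _ (2 * (M * ch t) + 2 * (M * ch s))) => n.
    rewrite [leLHS](_ : _ = `|(p n t - p n s) - (p n t - Z t) + (p n s - Z s)|);
      last by congr (`|_|); ring.
    apply: le_trans (ler_normD _ _) _; rewrite mulrDl addrA.
    apply: lerD (HZ s n); apply: le_trans (ler_normB _ _) _.
    exact: lerD (Hp n s t) (HZ t n).
  move=> t; apply/cvgrPdist_lt => e e0.
  have e' : 0 < e / (M + 1) by rewrite divr_gt0 // ltr_wpDl.
  near=> s; apply: le_lt_trans (ZL s t) _.
  have ts : ball t (e / (M + 1)) s by near: s; exact: nbhsx_ballx t _ e'.
  move: ts; rewrite /ball /= => ts.
  have : `|t - s| * (M + 1) < e by rewrite -ltr_pdivlMr // ltr_wpDl.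
  by have := normr_ge0 (t - s); lra.
have cX : continuous X.
  by apply: (lip X (fun n => (picard n).1)) => // n s t; have [] := picard_lipschitz n s t.
have cY : continuous Y.
  by apply: (lip Y (fun n => (picard n).2)) => // n s t; have [] := picard_lipschitz n s t.
(* The limit solves the integral equation: [p n.+1] is within a multiple of 2^-n of both sides. *)
have fixpt (W : R -> R -> R) (c : R) (Z : R -> R) (p : nat -> R -> R) :
    (forall a b a' b', `|W a b - W a' b'| <= L * (`|a - a'| + `|b - b'|)) ->
    (forall t n, `|p n t - Z t| <= 2 * (M * ch t) / 2 ^+ n) ->
    (forall n, p n 0 = c) ->
    (forall n t, is_derive t 1 (p n.+1) (W ((picard n).1 t) ((picard n).2 t))) ->
    forall t, Z t = c + primitive (fun s => W (X s) (Y s)) t.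
  move=> WL HZ pc Hp t.
  have [P1 P2] := primitiveP (continuous_lip2 WL cX cY).
  apply/eqP; rewrite -subr_eq0 -normr_le0.
  apply: (@le_of_geometric _ _ (2 * (M * ch t) + M * ch t)) => n; rewrite add0r.
  have n0 : 0 <= (2 ^+ n)^-1 :> R by rewrite invr_ge0 exprn_ge0.
  have d s := is_derive1B (Hp n s) (is_derive1D (is_derive1_cst s c) (P1 s)).
  have := @weighted_integration _ _ (4 * M / 2 ^+ n) _ _ d.
  rewrite pc P2 addr0 subrr => H.
  have {}H : `|p n.+1 t - (c + primitive (fun s => W (X s) (Y s)) t)|
      <= 4 * M / 2 ^+ n / 4 * ch t.
    apply: H => // [|s]; first by rewrite !mulr_ge0.
    rewrite add0r; apply: le_trans (WL _ _ _ _) _; apply: ler_wpM2l; first exact: ltW.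
    rewrite (_ : 4 * M / _ * _ = 2 * (M * ch s) / 2 ^+ n + 2 * (M * ch s) / 2 ^+ n); last by ring.
    by apply: lerD; [exact: HX | exact: HY].
  have := HZ t n.+1; rewrite distrC => H'.
  rewrite [leLHS](_ : _ = `|(Z t - p n.+1 t)
      + (p n.+1 t - (c + primitive (fun s => W (X s) (Y s)) t))|);
    last by congr (`|_|); ring.
  apply: le_trans (ler_normD _ _) _; apply: le_trans (lerD H' H) _.
  rewrite exprS invfM; set q := (2 ^+ n)^-1 in n0 *.
  have : 0 <= M * ch t * q by rewrite !mulr_ge0.
  lra.
have X_eq := fixpt U x0 X (fun n => (picard n).1) UL HX (fun n => (picard0 n).1)
  (fun n t => (picard_derive n t).1).
have Y_eq := fixpt V y0 Y (fun n => (picard n).2) VL HY (fun n => (picard0 n).2)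
  (fun n t => (picard_derive n t).2).
have [P1 P10] := primitiveP (continuous_lip2 UL cX cY).
have [Q1 Q10] := primitiveP (continuous_lip2 VL cX cY).
exists X, Y; split.
- by rewrite X_eq P10 addr0.
- by rewrite Y_eq Q10 addr0.
- move=> t; rewrite {1}(funext X_eq) -[X in is_derive _ _ _ X]add0r.
  exact: is_derive1D (is_derive1_cst t x0) (P1 t).
- move=> t; rewrite {1}(funext Y_eq) -[X in is_derive _ _ _ X]add0r.
  exact: is_derive1D (is_derive1_cst t y0) (Q1 t).
Unshelve. all: by end_near. Qed.

End Picard.

(** * The projected flow *)

Section Flow.
Variable R : realType.
Implicit Types (p : R * R) (c : R -> R * R).

(** The factors x and 1 - 2x show that x = 0 and x = 1/2 are invariant lines. *)
Lemma ufieldE (x y : R) : ufield (x, y) = 2 * x * (1 - 2 * x) * (1 - x - 6 * y * (1 - x - y)).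
Proof. rewrite /ufield; ring. Qed.

Lemma vfieldE (x y : R) : vfield (x, y) = ufield (y, x).
Proof. rewrite /vfield /ufield; ring. Qed.

(** The bound is carried along with the Lipschitz condition because products of bounded Lipschitz
    functions are again Lipschitz. *)
Definition bounded_lipschitz (f : R -> R -> R) : Prop :=
  exists L, [/\ 0 <= L, forall a b, `|f a b| <= L &
    forall a b a' b', `|f a b - f a' b'| <= L * (`|a - a'| + `|b - b'|)].

Lemma bounded_lipschitz_cst (k : R) : bounded_lipschitz (fun _ _ => k).
Proof. by exists `|k|; split => // *; rewrite subrr normr0 mulr_ge0 ?addr_ge0. Qed.

Lemma bounded_lipschitzD f g : bounded_lipschitz f -> bounded_lipschitz g ->
  bounded_lipschitz (fun a b => f a b + g a b).
Proof.
move=> [L [L0 Lf fL]] [M [M0 Mg gM]]; exists (L + M); split => [|a b|a b a' b'].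
- exact: addr_ge0.
- exact: le_trans (ler_normD _ _) (lerD _ _).
rewrite opprD addrACA mulrDl; exact: le_trans (ler_normD _ _) (lerD _ _).
Qed.

Lemma bounded_lipschitzN f : bounded_lipschitz f -> bounded_lipschitz (fun a b => - f a b).
Proof.
move=> [L [L0 Lf fL]]; exists L; split => // *; first by rewrite normrN.
by rewrite -opprD normrN.
Qed.

Lemma bounded_lipschitzM f g : bounded_lipschitz f -> bounded_lipschitz g ->
  bounded_lipschitz (fun a b => f a b * g a b).
Proof.
move=> [L [L0 Lf fL]] [M [M0 Mg gM]]; exists (L * M + L * M); split => [|a b|a b a' b'].
- by rewrite addr_ge0 ?mulr_ge0.
- by rewrite normrM -[leLHS]addr0 lerD ?ler_pM ?mulr_ge0.
have -> : f a b * g a b - f a' b' * g a' b' =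
  f a b * (g a b - g a' b') + (f a b - f a' b') * g a' b' by ring.
apply: le_trans (ler_normD _ _) _; rewrite !normrM [leRHS]mulrDl.
apply: lerD; first by rewrite -mulrA ler_pM.
by rewrite (mulrC L M) -mulrA mulrC ler_pM.
Qed.

Let clamp (a : R) := Num.min (Num.max a 0) 1.
Let ret1 (a b : R) := clamp a.
Let ret2 (a b : R) := Num.min (Num.max b 0) (1 - clamp a).

Let clampP a : [\/ a < 0 /\ clamp a = 0, 0 <= a <= 1 /\ clamp a = a | 1 < a /\ clamp a = 1].
Proof.
rewrite /clamp; case: (ltP a 0) => a0.
  by rewrite (min_idPl ler01); constructor 1.
case: (leP a 1) => a1.
  by constructor 2.
by constructor 3.
Qed.

Let clamp01 a : 0 <= clamp a <= 1.
Proof. by case: (clampP a) => -[h ->]; rewrite ?lexx ?ler01. Qed.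

Let clamp_lip a a' : `|clamp a - clamp a'| <= `|a - a'|.
Proof.
by case: (clampP a) => -[/= h ->]; case: (clampP a') => -[/= h' ->];
  rewrite ?subrr ?normr0 //; case: (ler0P (a - a')) => ?; rewrite ler_norml; lra.
Qed.

Let ret2E a b :
  [\/ b < 0 /\ ret2 a b = 0, 0 <= b <= 1 - clamp a /\ ret2 a b = b |
      1 - clamp a < b /\ ret2 a b = 1 - clamp a].
Proof.
have /andP[c0 c1] := clamp01 a.
rewrite /ret2; case: (ltP b 0) => b0.
  have /min_idPl -> : 0 <= 1 - clamp a by lra.
  by constructor 1.
case: (leP b (1 - clamp a)) => b1.
  by constructor 2.
by constructor 3.
Qed.

Let ret1_lip : bounded_lipschitz ret1.
Proof.
exists 1; split => // [a b|a b a' b']; rewrite /ret1.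
  by have /andP[? ?] := clamp01 a; rewrite ger0_norm.
by rewrite mul1r; apply: le_trans (clamp_lip a a') _; rewrite lerDl.
Qed.

Let ret2_lip : bounded_lipschitz ret2.
Proof.
exists 1; split => // [a b|a b a' b'].
  have /andP[c0 c1] := clamp01 a.
  by case: (ret2E a b) => -[h ->]; rewrite ler_norml; lra.
have := clamp_lip a a'; have /andP[c0 c1] := clamp01 a; have /andP[c0' c1'] := clamp01 a'.
rewrite mul1r => H; have := ler_norm (clamp a - clamp a'); have := ler_norm (clamp a' - clamp a).
rewrite distrC; have := ler_norm (b - b'); have := ler_norm (b' - b); rewrite (distrC b').
case: (ret2E a b) => -[/= h ->]; case: (ret2E a' b') => -[/= h' ->];
 rewrite ler_norml => ? ? ? ?; have := normr_ge0 (a - a'); lra.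
Qed.

Let ret_triangle x y : 0 <= x -> 0 <= y -> 0 <= 1 - x - y -> ret1 x y = x /\ ret2 x y = y.
Proof.
move=> x0 y0 xy; have c : clamp x = x by case: (clampP x) => -[h ->] //; lra.
by split => //; case: (ret2E x y) => -[h ->] //; rewrite ?c in h *; lra.
Qed.

(** Points beyond the edge x + y = 1 are retracted to that edge, where u + v = 0; there 1 - x - y
    has derivative zero along a solution. *)
Let ret_beyond x y : 0 <= x -> 0 <= y -> 1 - x - y < 0 -> ret2 x y = 1 - ret1 x y.
Proof.
move=> x0 y0 xy; rewrite /ret1; case: (ret2E x y) => -[] // h ->; first by lra.
by case: (clampP x) => -[h' E]; move: h; rewrite E => h; lra.
Qed.

Let U a b := ufield (ret1 a b, ret2 a b).
Let V a b := vfield (ret1 a b, ret2 a b).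

Let U_lip : bounded_lipschitz U.
Proof.
rewrite [U](_ : _ = fun a b => 2 * ret1 a b * (1 - 2 * ret1 a b)
   * (1 - ret1 a b - 6 * ret2 a b * (1 - ret1 a b - ret2 a b))).
  by repeat first [exact: bounded_lipschitz_cst | exact: ret1_lip | exact: ret2_lip
    | apply: bounded_lipschitzM | apply: bounded_lipschitzD | apply: bounded_lipschitzN].
by apply/funext => a; apply/funext => b; rewrite /U ufieldE.
Qed.

Let V_lip : bounded_lipschitz V.
Proof.
rewrite [V](_ : _ = fun a b => 2 * ret2 a b * (1 - 2 * ret2 a b)
   * (1 - ret2 a b - 6 * ret1 a b * (1 - ret2 a b - ret1 a b))).
  by repeat first [exact: bounded_lipschitz_cst | exact: ret1_lip | exact: ret2_lip
    | apply: bounded_lipschitzM | apply: bounded_lipschitzD | apply: bounded_lipschitzN].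
by apply/funext => a; apply/funext => b; rewrite /V vfieldE ufieldE.
Qed.

(* [U] and [V] are the field precomposed with the retraction
   [(ret1, ret2)] of the plane onto the triangle; a coordinate which becomes
   negative stops moving, so solutions never leave the triangle. *)
Lemma integral_curve_exists p : triangle p ->
  exists c, [/\ integral_curve c, c 0 = p & forall t, triangle (c t)].
Proof.
move=> [/= p1 p2 p12].
have [L [L0 LU UL]] := U_lip; have [M [M0 MV VM]] := V_lip.
have [LM1 LLM MLM] : [/\ 1 <= L + M + 1, L <= L + M + 1 & M <= L + M + 1] by split; lra.
have LMm (d : R) : 0 <= d -> L * d <= (L + M + 1) * d /\ M * d <= (L + M + 1) * d.
  by move=> d0; split; apply: ler_wpM2r => //; lra.
have [X [Y [X0 Y0 HX HY]]] := @picard_lindelof R U V (L + M + 1) (L + M + 1) p.1 p.2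
  LM1 (fun a b => le_trans (LU a b) LLM) (fun a b => le_trans (MV a b) MLM)
  (fun a b a' b' => le_trans (UL a b a' b') (LMm _ (addr_ge0 (normr_ge0 _) (normr_ge0 _))).1)
  (fun a b a' b' => le_trans (VM a b a' b') (LMm _ (addr_ge0 (normr_ge0 _) (normr_ge0 _))).2).
have Xge t : 0 <= X t.
  apply: (is_derive1_ge0_invariant HX); rewrite ?X0 // => s Xs.
  rewrite /U ufieldE /ret1; case: (clampP (X s)) => -[h ->]; [ring | lra | lra].
have Yge t : 0 <= Y t.
  apply: (is_derive1_ge0_invariant HY); rewrite ?Y0 // => s Ys.
  rewrite /V vfieldE ufieldE; case: (ret2E (X s) (Y s)) => -[h ->]; first ring.
    by lra.
  by have /andP[? ?] := clamp01 (X s); lra.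
have Zge t : 0 <= 1 - X t - Y t.
  apply: (is_derive1_ge0_invariant
    (fun s => is_derive1B (is_derive1B (is_derive1_cst s 1) (HX s)) (HY s))).
    by rewrite X0 Y0; lra.
  move=> s Zs.
  have -> : V (X s) (Y s) = - U (X s) (Y s); last by ring.
  have E := ret_beyond (Xge s) (Yge s) Zs.
  by rewrite /V /U vfieldE !ufieldE E; ring.
(* Inside the triangle the retraction is the identity, so (X, Y) solves the original system. *)
have XY s := ret_triangle (Xge s) (Yge s) (Zge s).
exists (fun t => (X t, Y t)); split => [t| |t].
- by split; [have := HX t; rewrite /U | have := HY t; rewrite /V]; have [-> ->] := XY t.
- by rewrite X0 Y0 -surjective_pairing.
- by split => /=; have := Zge t; rewrite ?Xge ?Yge //; lra.
Qed.

End Flow.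

(** * Continuity of polynomial expressions in continuous functions *)

Section Continuity.
Variable R : realType.

(** A named predicate on abstractions, on whose body the tactic [continuity] can match. *)
Definition cont (f : R -> R) : Prop := continuous f.

Lemma contD (f g : R -> R) : cont f -> cont g -> cont (fun t => f t + g t).
Proof. by move=> cf cg t; apply: cvgD; [exact: cf | exact: cg]. Qed.

Lemma contM (f g : R -> R) : cont f -> cont g -> cont (fun t => f t * g t).
Proof. by move=> cf cg t; apply: cvgM; [exact: cf | exact: cg]. Qed.

Lemma contN (f : R -> R) : cont f -> cont (fun t => - f t).
Proof. by move=> cf t; apply: cvgN; exact: cf. Qed.

Lemma contX (f : R -> R) n : cont f -> cont (fun t => f t ^+ n).
Proof.
move=> cf; elim: n => [|n IH]; first by move=> t; exact: cvg_cst.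
by rewrite [X in cont X](_ : _ = fun t => f t * f t ^+ n);
  [exact: contM | apply/funext => t; rewrite exprS].
Qed.

Lemma cont_norm (f : R -> R) : cont f -> cont (fun t => `|f t|).
Proof. by move=> cf t; apply: cvg_norm; exact: cf. Qed.

Lemma cont_cst (k : R) : cont (fun=> k).
Proof. by move=> t; exact: cvg_cst. Qed.

End Continuity.

Ltac continuity := lazymatch goal with
  | |- cont (fun t => @?f t + @?g t) => apply: (@contD _ f g); continuity
  | |- cont (fun t => @?f t * @?g t) => apply: (@contM _ f g); continuity
  | |- cont (fun t => - (@?f t)) => apply: (@contN _ f); continuity
  | |- cont (fun t => (@?f t) ^+ ?n) => apply: (@contX _ f n); continuity
  | |- cont (fun t => `|@?f t|) => apply: (@cont_norm _ f); continuity
  | |- _ => first [assumption | exact (@cont_cst _ _)]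
  end.

(** * Uniqueness of integral curves and invariant lines of the field *)

Section FlowProperties.
Variable R : realType.
Implicit Types (p : R * R) (c : R -> R * R).

Lemma integral_curve_continuous c : integral_curve c ->
  cont (fun t => (c t).1) /\ cont (fun t => (c t).2).
Proof.
by move=> Hc; split=> t; [exact: is_derive1_continuous (Hc t).1
  | exact: is_derive1_continuous (Hc t).2].
Qed.

Lemma integral_curve_swap c : integral_curve c -> integral_curve (fun t => ((c t).2, (c t).1)).
Proof.
move=> Hc t; have [H1 H2] := Hc t; split.
  by move: H2; rewrite (surjective_pairing (c t)) vfieldE.
by move: H1; rewrite (surjective_pairing (c t)) -vfieldE.
Qed.

(* The two divided differences of [ufield]. *)
Let P (x x' y : R) := 2 * (2 - 12 * y) * (x ^+ 2 + x * x' + x' ^+ 2)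
  - 6 * (4 * y ^+ 2 - 6 * y + 1) * (x + x') + 2 * (6 * y ^+ 2 - 6 * y + 1).
Let Q (x' y y' : R) := - (24 * x' ^+ 3) - 6 * x' ^+ 2 * (4 * (y + y') - 6)
  + 2 * x' * (6 * (y + y') - 6).

Let ufieldB (x y x' y' : R) : ufield (x, y) - ufield (x', y') =
  (x - x') * P x x' y + (y - y') * Q x' y y'.
Proof. rewrite /ufield /P /Q; ring. Qed.

(** Gronwall for the squared distance [D]. The divided differences bound |D'| by [k t * D t] with
    [k] continuous along the two curves, which may lie anywhere in the plane. *)
Lemma integral_curve_unique c d : integral_curve c -> integral_curve d ->
  c 0 = d 0 -> c = d.
Proof.
move=> Hc Hd cd0.
have [cX cY] := integral_curve_continuous Hc; have [dX dY] := integral_curve_continuous Hd.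
pose x t := (c t).1; pose y t := (c t).2; pose x' t := (d t).1; pose y' t := (d t).2.
pose k t := 2 * (`|P (x t) (x' t) (y t)| + `|Q (x' t) (y t) (y' t)|
  + `|P (y t) (y' t) (x t)| + `|Q (y' t) (x t) (x' t)|).
have ck : cont k by rewrite /k /P /Q /x /y /x' /y'; continuity.
pose D t := (x t - x' t) * (x t - x' t) + (y t - y' t) * (y t - y' t).
have HD t := is_derive1D
   (is_derive1M (is_derive1B (Hc t).1 (Hd t).1) (is_derive1B (Hc t).1 (Hd t).1))
   (is_derive1M (is_derive1B (Hc t).2 (Hd t).2) (is_derive1B (Hc t).2 (Hd t).2)).
have D0 t : 0 <= D t by rewrite addr_ge0 // -expr2 sqr_ge0.
have bound (a b p1 q1 p2 q2 : R) :
    `|a * (a * p1 + b * q1) + a * (a * p1 + b * q1)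
      + (b * (b * p2 + a * q2) + b * (b * p2 + a * q2))|
    <= 2 * (`|p1| + `|q1| + `|p2| + `|q2|) * (a * a + b * b).
  have ab : `|a * b| <= a * a + b * b.
    by rewrite ler_norml; have := sqr_ge0 (a + b); have := sqr_ge0 (a - b); rewrite !expr2; nra.
  have aa : `|a * a| <= a * a + b * b by rewrite ger0_norm -?expr2 ?sqr_ge0 // lerDl sqr_ge0.
  have bb : `|b * b| <= a * a + b * b by rewrite ger0_norm -?expr2 ?sqr_ge0 // lerDr sqr_ge0.
  rewrite (_ : _ + _ = 2 * (p1 * (a * a) + q1 * (a * b) + p2 * (b * b) + q2 * (a * b)));
    last by ring.
  rewrite normrM (@ger0_norm _ 2) // -mulrA ler_wpM2l //.
  apply: le_trans (ler_normD _ _) _; rewrite !mulrDl; apply: lerD; last by rewrite normrM ler_wpM2l.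
  apply: le_trans (ler_normD _ _) _; apply: lerD; last by rewrite normrM ler_wpM2l.
  apply: le_trans (ler_normD _ _) _; apply: lerD; by rewrite normrM ler_wpM2l.
have DE := gronwall0 ck HD D0 _ _.
apply/funext => t.
have : D t = 0.
  apply: DE => [s|]; last by rewrite /D /x /y cd0 !subrr mulr0 addr0.
  rewrite (surjective_pairing (c s)) (surjective_pairing (d s)) !vfieldE !ufieldB.
  exact: bound.
move/eqP; rewrite /D -!expr2 paddr_eq0 ?sqr_ge0 // !sqrf_eq0 !subr_eq0 => /andP[/eqP e1 /eqP e2].
by rewrite (surjective_pairing (c t)) (surjective_pairing (d t)) -/(x t) -/(y t) e1 e2.
Qed.

Lemma exists_projected_flow : exists phi : R * R -> R -> R * R, projected_flow phi.
Proof.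
have /choice [phi Hphi] : forall p, exists c, triangle p ->
    [/\ integral_curve c, c 0 = p & forall t, triangle (c t)].
  move=> p; have [tp|ntp] := pselect (triangle p); last by exists (fun=> p) => /ntp.
  by have [c Hc] := integral_curve_exists tp; exists c.
exists phi => p /Hphi[H1 H2 H3]; split => // c Hc c0 t.
by rewrite (integral_curve_unique Hc H1) // c0 H2.
Qed.

(** The edges of the triangle and of its medial triangle are invariant lines: each affine function
    divides its own derivative along the field, so it keeps its sign for all times. *)
Lemma integral_curve_factor_exp c : integral_curve c ->
  [/\ exists K : R -> R, forall t, (c t).1 = (c 0).1 * expR (K t),
      exists K : R -> R, forall t, (c t).2 = (c 0).2 * expR (K t) &
      exists K : R -> R, forall t,
        1 - (c t).1 - (c t).2 = (1 - (c 0).1 - (c 0).2) * expR (K t)] /\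
  [/\ exists K : R -> R, forall t, 1 - 2 * (c t).1 = (1 - 2 * (c 0).1) * expR (K t),
      exists K : R -> R, forall t, 1 - 2 * (c t).2 = (1 - 2 * (c 0).2) * expR (K t) &
      exists K : R -> R, forall t,
        2 * ((c t).1 + (c t).2) - 1 = (2 * ((c 0).1 + (c 0).2) - 1) * expR (K t)].
Proof.
move=> Hc; have [cX cY] := integral_curve_continuous Hc.
pose x t := (c t).1; pose y t := (c t).2.
have main (f k : R -> R) : cont k -> (forall t, is_derive t (1 : R) f (f t * k t)) ->
    exists K : R -> R, forall t, f t = f 0 * expR (K t).
  by move=> ck Hf; have [K [_ _ H]] := linear_ode_exp ck Hf; exists K.
have HX (t : R) : is_derive t 1 x (ufield (x t, y t)).
  by rewrite -surjective_pairing; exact: (Hc t).1.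
have HY (t : R) : is_derive t 1 y (ufield (y t, x t)).
  by rewrite -vfieldE -surjective_pairing; exact: (Hc t).2.
have eq_der (f : R -> R) (t a b : R) : a = b -> is_derive t 1 f a -> is_derive t 1 f b by move=> ->.
split; split.
- apply: (main x (fun t => 2 * (1 - 2 * x t) * (1 - x t - 6 * y t * (1 - x t - y t)))).
    by rewrite /x /y; continuity.
  by move=> t; apply: eq_der (HX t); rewrite ufieldE; ring.
- apply: (main y (fun t => 2 * (1 - 2 * y t) * (1 - y t - 6 * x t * (1 - y t - x t)))).
    by rewrite /x /y; continuity.
  by move=> t; apply: eq_der (HY t); rewrite ufieldE; ring.
- apply: (main (fun t => 1 - x t - y t)
    (fun t => 2 * (2 * x t + 2 * y t - 1) * (x t + y t - 6 * x t * y t))).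
    by rewrite /x /y; continuity.
  move=> t; apply: eq_der (is_derive1B (is_derive1B (is_derive1_cst t 1) (HX t)) (HY t)).
  by rewrite !ufieldE; ring.
- apply: (main (fun t => 1 - 2 * x t)
    (fun t => - 4 * x t * (1 - x t - 6 * y t * (1 - x t - y t)))).
    by rewrite /x /y; continuity.
  move=> t; apply: eq_der (is_derive1B (is_derive1_cst t 1) (is_derive1Z 2 (HX t))).
  by rewrite !ufieldE; ring.
- apply: (main (fun t => 1 - 2 * y t)
    (fun t => - 4 * y t * (1 - y t - 6 * x t * (1 - y t - x t)))).
    by rewrite /x /y; continuity.
  move=> t; apply: eq_der (is_derive1B (is_derive1_cst t 1) (is_derive1Z 2 (HY t))).
  by rewrite !ufieldE; ring.
- apply: (main (fun t => 2 * (x t + y t) - 1)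
    (fun t => - 4 * (1 - x t - y t) * (x t + y t - 6 * x t * y t))).
    by rewrite /x /y; continuity.
  move=> t; apply: eq_der (is_derive1B (is_derive1Z 2 (is_derive1D (HX t) (HY t)))
    (is_derive1_cst t 1)).
  by rewrite !ufieldE; ring.
Qed.

(** Here f = f 0 exp(K) with K t >= e t, and exp(s) >= 1 + s already gives linear growth. The
    witness makes f 0 (1 + e t) equal to f 0 + |B|. *)
Lemma exp_growth_unbounded (f k : R -> R) (e B : R) : cont k ->
  (forall t : R, is_derive t 1 f (f t * k t)) -> 0 < f 0 -> 0 < e ->
  (forall t, 0 <= t -> e <= k t) -> exists2 t, 0 <= t & B < f t.
Proof.
move=> ck Hf f0 e0 ke; have [K [HK K0 HfK]] := linear_ode_exp ck Hf.
have Kge t : 0 <= t -> e * t <= K t.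
  move=> t0; have H (s : R) := is_derive1B (HK s) (is_derive1Z e (is_derive_id s (1 : R))).
  have := is_derive1_le t0 (fun s _ => H s); rewrite K0 mulr0 subr0 subr_ge0; apply.
  by move=> s /andP[s0 _]; rewrite mulr1 subr_ge0 ke.
pose t := `|B| / (f 0 * e).
have t0 : 0 <= t by apply: divr_ge0 => //; apply: mulr_ge0; exact: ltW.
exists t => //; rewrite HfK.
apply: (@lt_le_trans _ _ (f 0 * (1 + e * t))).
  have -> : f 0 * (1 + e * t) = f 0 + `|B| by rewrite /t; field; rewrite !gt_eqF.
  by have := ler_norm B; lra.
rewrite ler_pM2l //; apply: le_trans (expR_ge1Dx _).
by rewrite lerD2l Kge.
Qed.

End FlowProperties.

(** * Invariant regions, and exits from positivity along the diagonal *)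

Section InvariantRegions.
Variable R : realType.
Implicit Types (p : R * R) (c : R -> R * R).

Lemma open_medial : open (@medial R).
Proof.
have c1 : continuous (fun p : R * R => p.1) by move=> p; exact: cvg_fst.
have c2 : continuous (fun p : R * R => p.2) by move=> p; exact: cvg_snd.
have c12 : continuous (fun p : R * R => p.1 + p.2).
  by move=> p; apply: cvgD; [exact: c1 | exact: c2].
rewrite (_ : @medial R = (fun p : R * R => p.1) @^-1` [set r | r < 2^-1]
  `&` (fun p : R * R => p.2) @^-1` [set r | r < 2^-1]
  `&` (fun p : R * R => p.1 + p.2) @^-1` [set r | 2^-1 < r]).
  by apply: openI; [apply: openI|]; apply: open_comp.
by apply/seteqP; split=> p /=; [case=> *; split=> // | case=> -[]].
Qed.

Lemma closure_medial p : closure (@medial R) p <->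
  [/\ p.1 <= 2^-1, p.2 <= 2^-1 & 2^-1 <= p.1 + p.2].
Proof.
split=> [cp|[p1 p2 p12] B /nbhs_ballP [e /= e0 eB]].
  have near_p e : 0 < e -> exists q, [/\ medial q, `|p.1 - q.1| < e & `|p.2 - q.2| < e].
    move=> e0; have [q [mq [q1 q2]]] := cp _ (nbhsx_ballx p e e0).
    by exists q.
  split; rewrite leNgt; apply/negP => h.
  - have [q [[q1 _ _]]] := near_p _ (ltac:(by rewrite subr_gt0) : 0 < p.1 - 2^-1).
    by rewrite ltr_norml => /andP[_ ?] _; lra.
  - have [q [[_ q2 _]]] := near_p _ (ltac:(by rewrite subr_gt0) : 0 < p.2 - 2^-1).
    by rewrite !ltr_norml => _ /andP[_ ?]; lra.
  - have e0 : 0 < (2^-1 - (p.1 + p.2)) / 2 by rewrite divr_gt0 // subr_gt0.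
    have [q [[_ _ q12]]] := near_p _ e0.
    by rewrite !ltr_norml => /andP[? ?] /andP[? ?]; lra.
pose d := Num.min e 1 / 2.
have m0 : 0 < Num.min e 1 by rewrite lt_min e0 ltr01.
have d0 : 0 < d by rewrite divr_gt0.
have d1 : d < 1.
  have : Num.min e 1 <= 1 by rewrite ge_min lexx orbT.
  by rewrite /d; lra.
have de : d < e.
  have : Num.min e 1 <= e by rewrite ge_min lexx.
  by move: m0; rewrite /d; lra.
(* The point is moved by the fraction [d] towards the centroid (1/3, 1/3), which makes all three
   inequalities strict. *)
exists (p.1 + d * (3^-1 - p.1), p.2 + d * (3^-1 - p.2)); split.
  by split => /=; nra.
apply: eB; split; rewrite /ball /= opprD addrA subrr add0r normrN normrM (gtr0_norm d0).
  apply: le_lt_trans de; rewrite -[leRHS]mulr1; apply: ler_wpM2l; first exact: ltW.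
  by rewrite ler_norml; apply/andP; split; lra.
apply: le_lt_trans de; rewrite -[leRHS]mulr1; apply: ler_wpM2l; first exact: ltW.
by rewrite ler_norml; apply/andP; split; lra.
Qed.

Definition region5 : set (R * R) := closure (@medial R)
  `\` [set (2^-1, 0); (0, 2^-1); (2^-1, 2^-1)].

(** The three vertices are exactly the points of the closed medial triangle on the boundary of the
    parameter triangle. *)
Lemma region5P p : region5 p <->
  [/\ p.1 <= 2^-1, p.2 <= 2^-1, 2^-1 <= p.1 + p.2 & inv_metric p].
Proof.
case: p => x y; split.
  move=> [/closure_medial [/= x1 y1 xy] nv].
  have [nv1 nv2 nv3] : [/\ (x, y) <> (2^-1, 0), (x, y) <> (0, 2^-1) & (x, y) <> (2^-1, 2^-1)].
    by split => h; apply: nv; rewrite h; [left; left | left; right | right].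
  split => //; split => /=; rewrite ltNge; apply/negP => h.
  - by apply: nv2; congr (_, _); lra.
  - by apply: nv1; congr (_, _); lra.
  - by apply: nv3; congr (_, _); lra.
move=> [/= x1 y1 xy [/= x0 y0 xy1]]; split; first by apply/closure_medial; split.
by move=> [[|]|] /= h; case: h => h1 h2; lra.
Qed.

Lemma region5_secRic5 : region5 `<` secRic R 5.
Proof.
split=> [p /region5P [x1 y1 xy gm]|H].
  have [x0 y0 xy1] := gm.
  (* The triangle inequalities give x^2 >= (y - z)^2, hence 6yz + x^2 - y^2 - z^2 >= 4yz > 0, and
     likewise for the other two. *)
  by apply: ricci_gt0_secRic5 => //; nra.
(* This metric has positive Ricci curvature, as 3/16 > 1/8, but violates 1/2 <= x + y. *)
have : region5 (3 / 16, 3 / 16).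
  apply: H; apply: ricci_gt0_secRic5 => /=; try (by lra).
  by split => /=; lra.
by move=> /region5P [/= _ _]; lra.
Qed.

Lemma diagonal_ricci_gt0 (x : R) : 8^-1 < x < 4^-1 -> secRic R 5 (x, x).
Proof.
move=> /andP[x1 x2]; have gm : inv_metric (x, x) by split => /=; lra.
by apply: (ricci_gt0_secRic5 gm) => /=; nra.
Qed.

Lemma triangle_inv_metric p : inv_metric p -> triangle p.
Proof. by case=> ? ? ?; split; exact: ltW. Qed.

Section Invariance.
Variable phi : R * R -> R -> R * R.
Hypothesis Hphi : projected_flow phi.

Lemma medial_invariant p t : medial p -> medial (phi p t).
Proof.
move=> pm; have [x1 y1 xy] := pm.
have [Hc c0 _ _] := Hphi (triangle_inv_metric (medial_inv_metric pm)).
have [_ [[K1 H1] [K2 H2] [K3 H3]]] := integral_curve_factor_exp Hc.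
have := H1 t; have := H2 t; have := H3 t; rewrite c0.
have := expR_gt0 (K1 t); have := expR_gt0 (K2 t); have := expR_gt0 (K3 t).
move: (expR (K3 t)) (expR (K2 t)) (expR (K1 t)) => e3 e2 e1 e30 e20 e10 h3 h2 h1.
have ? : 0 < (1 - 2 * p.1) * e1 by rewrite mulr_gt0 //; lra.
have ? : 0 < (1 - 2 * p.2) * e2 by rewrite mulr_gt0 //; lra.
have ? : 0 < (2 * (p.1 + p.2) - 1) * e3 by rewrite mulr_gt0 //; lra.
by split; lra.
Qed.

Lemma region5_invariant p t : region5 p -> region5 (phi p t).
Proof.
move=> /region5P [x1 y1 xy pm]; have [x0 y0 z0] := pm.
have [Hc c0 _ _] := Hphi (triangle_inv_metric pm).
have [[[J1 G1] [J2 G2] [J3 G3]] [[K1 H1] [K2 H2] [K3 H3]]] := integral_curve_factor_exp Hc.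
have := G1 t; have := G2 t; have := G3 t.
have := H1 t; have := H2 t; have := H3 t; rewrite c0.
have := expR_gt0 (K1 t); have := expR_gt0 (K2 t); have := expR_gt0 (K3 t).
have := expR_gt0 (J1 t); have := expR_gt0 (J2 t); have := expR_gt0 (J3 t).
move: (expR (J3 t)) (expR (J2 t)) (expR (J1 t)) (expR (K3 t)) (expR (K2 t)) (expR (K1 t)).
move=> f3 f2 f1 e3 e2 e1 f30 f20 f10 e30 e20 e10 h3 h2 h1 g3 g2 g1.
have ? : 0 <= (1 - 2 * p.1) * e1 by apply: mulr_ge0; lra.
have ? : 0 <= (1 - 2 * p.2) * e2 by apply: mulr_ge0; lra.
have ? : 0 <= (2 * (p.1 + p.2) - 1) * e3 by apply: mulr_ge0; lra.
have ? : 0 < p.1 * f1 by rewrite mulr_gt0.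
have ? : 0 < p.2 * f2 by rewrite mulr_gt0.
have ? : 0 < (1 - p.1 - p.2) * f3 by rewrite mulr_gt0 //; lra.
by apply/region5P; split; [lra | lra | lra | split; lra].
Qed.

(** The mirror image of the solution is a solution with the same initial point. *)
Lemma diagonal_invariant (x t : R) : triangle (x, x) -> (phi (x, x) t).2 = (phi (x, x) t).1.
Proof.
move=> tx; have [Hc c0 _ uniq] := Hphi tx.
have := uniq _ (integral_curve_swap Hc); rewrite c0 => /(_ erefl t) /(congr1 fst).
by [].
Qed.

Lemma diagonal_derive (x t : R) : triangle (x, x) ->
  let u := (phi (x, x) t).1 in
  is_derive t 1 (fun s => (phi (x, x) s).1) (2 * u * (1 - 2 * u) * (1 - 3 * u) * (1 - 4 * u)).
Proof.
move=> tx u; have [Hc _ _ _] := Hphi tx; have [+ _] := Hc t.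
rewrite (surjective_pairing (phi (x, x) t)) diagonal_invariant // ufieldE -/u.
by rewrite (_ : 1 - u - _ = (1 - 3 * u) * (1 - 4 * u)) ?mulrA //; ring.
Qed.

Lemma diagonal_continuous (x : R) : triangle (x, x) -> cont (fun s => (phi (x, x) s).1).
Proof. by move=> tx; have [Hc _ _ _] := Hphi tx; have [] := integral_curve_continuous Hc. Qed.

Lemma diagonal_near (x s a b : R) : triangle (x, x) -> a < (phi (x, x) s).1 < b ->
  \forall t \near s, phi (x, x) t = ((phi (x, x) t).1, (phi (x, x) t).1) /\
    a < (phi (x, x) t).1 < b.
Proof.
move=> tx /andP[sa sb].
have us : (fun r : R => (phi (x, x) r).1) @ s --> (phi (x, x) s).1.
  exact: diagonal_continuous tx s.
have ua := cvgr_gt _ us _ sa; have ub := cvgr_lt _ us _ sb.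
near=> t; split; first by rewrite {1}(surjective_pairing (phi _ t)) diagonal_invariant.
by apply/andP; split; near: t; [exact: ua | exact: ub].
Unshelve. all: by end_near. Qed.

Lemma diagonal_ge0_le_half (x t : R) : triangle (x, x) -> 0 <= (phi (x, x) t).1 <= 2^-1.
Proof.
move=> tx; have [_ _ tt _] := Hphi tx; have [+ _ +] := tt t.
by rewrite diagonal_invariant // => ? ?; apply/andP; split; lra.
Qed.

(** Were u >= 5/18 for all t >= 0, then 1 - 3u, which stays positive, would grow at relative rate at
    least 1/20, although it is at most 1. *)
Lemma forward_exit : exists2 t, 0 <= t & (phi (5 / 16, 5 / 16) t).1 < 5 / 18.
Proof.
have tx : triangle (5 / 16 : R, 5 / 16) by split => /=; lra.
have [_ c0 _ _] := Hphi tx.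
apply: contrapT => /forall2NP H.
have ge t : 0 <= t -> 5 / 18 <= (phi (5 / 16, 5 / 16) t).1.
  by move=> t0; have [//|/negP] := H t; rewrite -leNgt.
pose u t := (phi (5 / 16, 5 / 16) t).1.
pose k t := 6 * u t * (1 - 2 * u t) * (4 * u t - 1).
have cu : cont u by exact: diagonal_continuous.
have ck : cont k by rewrite /k; continuity.
have df (t : R) : is_derive t 1 (fun s => 1 - 3 * u s) ((1 - 3 * u t) * k t).
  have := is_derive1B (is_derive1_cst t 1) (is_derive1Z 3 (diagonal_derive t tx)).
  rewrite /= -/(u t) (_ : 0 - _ = (1 - 3 * u t) * k t) //.
  by rewrite /k; ring.
have f0 : 0 < 1 - 3 * u 0 by rewrite /u c0 /=; lra.
have f_gt0 t : 0 < 1 - 3 * u t.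
  have [K [_ _ ->]] := linear_ode_exp ck df; by rewrite mulr_gt0 ?expR_gt0.
have [||t t0] := @exp_growth_unbounded _ _ _ 20^-1 1 ck df f0.
- by rewrite invr_gt0.
- move=> t t0; have := ge t t0; have := f_gt0 t; rewrite -/(u t) /k.
  move: (u t) => w w3 w5.
  have : (5 / 18) * 3^-1 <= w * (1 - 2 * w) by apply: ler_pM; lra.
  have : 9^-1 <= 4 * w - 1 by lra.
  by nra.
by have /andP[] := diagonal_ge0_le_half t tx; rewrite -/(u t); lra.
Qed.

(** The same argument in reversed time: while u >= 1/8, the positive quantity 1 - 4u grows at
    relative rate at least 1/8. *)
Lemma backward_exit : exists2 t, t <= 0 & (phi (3 / 16, 3 / 16) t).1 < 8^-1.
Proof.
have tx : triangle (3 / 16 : R, 3 / 16) by split => /=; lra.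
have [_ c0 _ _] := Hphi tx.
apply: contrapT => /forall2NP H.
pose u t := (phi (3 / 16, 3 / 16) (- t)).1.
have ge t : 0 <= t -> 8^-1 <= u t.
  by move=> t0; have [|/negP] := H (- t); rewrite ?oppr_le0 // -leNgt.
pose k t := 8 * u t * (1 - 2 * u t) * (1 - 3 * u t).
have cu : cont u.
  by move=> t; exact: is_derive1_continuous (is_derive1_reflect (diagonal_derive (- t) tx)).
have ck : cont k by rewrite /k; continuity.
have df (t : R) : is_derive t 1 (fun s => 1 - 4 * u s) ((1 - 4 * u t) * k t).
  have := is_derive1B (is_derive1_cst t 1)
    (is_derive1Z 4 (is_derive1_reflect (diagonal_derive (- t) tx))).
  rewrite /= -/(u t) (_ : 0 - _ = (1 - 4 * u t) * k t) //.
  by rewrite /k; ring.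
have f0 : 0 < 1 - 4 * u 0 by rewrite /u oppr0 c0 /=; lra.
have f_gt0 t : 0 < 1 - 4 * u t.
  have [K [_ _ ->]] := linear_ode_exp ck df; by rewrite mulr_gt0 ?expR_gt0.
have [||t t0] := @exp_growth_unbounded _ _ _ 8^-1 1 ck df f0.
- by rewrite invr_gt0.
- move=> t t0; have := ge t t0; have := f_gt0 t; rewrite /k.
  move: (u t) => w w4 w8.
  have : 8^-1 * 2^-1 <= w * (1 - 2 * w) by apply: ler_pM; lra.
  have : 4^-1 <= 1 - 3 * w by lra.
  by nra.
by have /andP[] := diagonal_ge0_le_half (- t) tx; rewrite -/(u t); lra.
Qed.

End Invariance.
End InvariantRegions.

Theorem theorem1p1 (R : realType) :
  (forall d : nat, (1 <= d <= 5)%N -> secRic R d !=set0) /\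
  exists phi : R * R -> R -> R * R,
    [/\ projected_flow phi,
        (* (a) *)
        (forall d : nat, d \in [:: 1; 2; 3; 5]%N ->
          exists (g : R * R) (tstar : R),
            [/\ secRic R d g,
                (\forall t \near (0 : R), secRic R d (phi g t))
              & (\forall t \near tstar, ~ secRic R d (phi g t))])
        (* (b) *)
      & exists Reg : nat -> set (R * R),
          [/\ (forall d : nat, d \in [:: 4; 5]%N ->
                 Reg d `<=` secRic R d /\
                 forall g, Reg d g -> forall t : R, Reg d (phi g t)),
              Reg 4%N = secRic R 4,
              open (Reg 4%N),
              Reg 5%N = closure (Reg 4%N)
                `\` [set (2^-1, 0); (0, 2^-1); (2^-1, 2^-1)]
            & Reg 5%N `<` secRic R 5]].
Proof.
split=> [d /andP[d0 _]|].
  (* The value 5/16 lies in the window from 31/100 to 63/200, where every Ric_d is positive. *)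
  by exists (5 / 16, 5 / 16); apply: diagonal_secRic => //; lra.
have [phi Hphi] := exists_projected_flow R; exists phi; split => //.
- move=> d; have [->|d5] := eqVneq d 5%N => [_|].
    have tx : triangle (3 / 16 : R, 3 / 16) by split => /=; lra.
    have [_ c0 _ _] := Hphi _ tx.
    have [t t0 tlt] := backward_exit Hphi.
    exists (3 / 16, 3 / 16), t; split; first by apply: diagonal_ricci_gt0; lra.
      have : (8^-1 : R) < (phi (3 / 16, 3 / 16) 0).1 < 4^-1 by rewrite c0 /=; lra.
      move=> /(diagonal_near Hphi tx); apply: filterS => s [-> H]; exact: diagonal_ricci_gt0.
    (* The lower bound -1 only completes the two-sided interval of [diagonal_near]. *)
    have : -1 < (phi (3 / 16, 3 / 16) t).1 < 8^-1.
      by rewrite tlt andbT; have /andP[] := diagonal_ge0_le_half Hphi t tx; lra.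
    move=> /(diagonal_near Hphi tx); apply: filterS => s [-> /andP[_ H]].
    by move/diagonal_secRic5; rewrite ltNge ltW.
  move=> d1235; have d123 : d \in [:: 1; 2; 3]%N.
    by move: d1235; rewrite !inE (negbTE d5) orbF.
  have d0 : (0 < d)%N by move: d123; rewrite !inE => /or3P[] /eqP->.
  have tx : triangle (5 / 16 : R, 5 / 16) by split => /=; lra.
  have [_ c0 _ _] := Hphi _ tx.
  have [t t0 tlt] := forward_exit Hphi.
  exists (5 / 16, 5 / 16), t; split; first by apply: diagonal_secRic => //; lra.
    have : (31 / 100 : R) < (phi (5 / 16, 5 / 16) 0).1 < 63 / 200 by rewrite c0 /=; lra.
    move=> /(diagonal_near Hphi tx); apply: filterS => s [-> H]; exact: diagonal_secRic.
  have : -1 < (phi (5 / 16, 5 / 16) t).1 < 5 / 18.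
    by rewrite tlt andbT; have /andP[] := diagonal_ge0_le_half Hphi t tx; lra.
  move=> /(diagonal_near Hphi tx); apply: filterS => s [-> /andP[_ H]].
  by move/(diagonal_secRic3 d123); rewrite ltNge ltW.
exists (fun d => if d == 4%N then @medial R else @region5 R); split => //=.
- move=> d; rewrite !inE => /orP[] /eqP -> /=; split.
  + by rewrite secRic4E.
  + by move=> g gm t; exact: medial_invariant.
  + by case: (@region5_secRic5 R).
  + by move=> g gm t; exact: region5_invariant.
- by rewrite secRic4E.
- exact: open_medial.
- exact: region5_secRic5.
Qed.
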